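(* Let $\mathbf{M}=(\Omega,\mathcal{F},\mathbb{F},P,Y,S)$ and $\tilde{\mathbf{M}}=(\tilde\Omega,\tilde{\mathcal{F}},\tilde{\mathbb{F}},\tilde P,\tilde Y,\tilde S)$ be two market models such that each of the processes $Y$ (under $P$) and $\tilde Y$ (under $\tilde P$) has independent increments (with the convention $Y_{0-}=0$, $\tilde Y_{0-}=0$, so that $Y_0$ and $\tilde Y_0$ are considered as increments), and such that the laws coincide: $\mathcal{L}_P(Y,S)=\mathcal{L}_{\tilde P}(\tilde Y,\tilde S)$. Then for every $x\in K$, $$u(x,\mathbf{M})=u(x,\tilde{\mathbf{M}}).$$
   Context: Fix $p,d\in\mathbb{N}$, $T\in\mathbb{R}_{++}:=(0,\infty)$. Let $\mathcal{D}^d_T$ be the space of all RCLL (right-continuous with left limits) functions $f:[0,T]\to\mathbb{R}^d$. Fix a closed convex cone $K\subset\mathbb{R}^d$ that is proper, i.e. $K\cap(-K)=\{0\}$, and such that $\mathbb{R}^d_{++}\subset K$. Fix a utility function $U:K\to\mathbb{R}\cup\{-\infty\}$ (it is implicit that $U$ is Borel and that the expectations below make sense). The objects $p,d,T,K,U$ are the same for both models. Market model. A model $\mathbf{M}=(\Omega,\mathcal{F},\mathbb{F},P,Y,S)$ consists of a stochastic basis $(\Omega,\mathcal{F},\mathbb{F}=(\mathcal{F}_t)_{t\in[0,T]},P)$, an $\mathbb{R}^p$-valued process $Y$ with RCLL paths such that the filtration $\mathbb{F}$ is generated by $Y$ and the null sets of $\mathcal{F}$, and an $\mathbb{R}^d_{++}$-valued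 $\mathbb{F}$-adapted process $S=(S^1,\dots,S^d)$ with continuous paths, $S_0=(1,\dots,1)$ and $S^1\equiv 1$. Strategies. A function $f:[0,T]\to\mathbb{R}^d$ is $K$-increasing if $f(t)-f(s)\in K$ for all $0\le s\le t\le T$, and $K$-decreasing if it is $(-K)$-increasing. $\mathcal{H}_K$ is the set of all $K$-decreasing paths in $\mathcal{D}^d_T$. A strategy is an adapted process $B=(B_t)_{t\in[0,T]}$ with paths in $\mathcal{H}_K$ (such paths are of finite variation). Wealth. For an initial value $x\in K$ and a strategy $B$, put $\widehat V^j_t:=x^j+\int_{[0,t]}\frac{1}{S^j_s}\,dB^j_s$ (Riemann–Stieltjes integral, with the convention $B_{0-}=0$, so that the integrator has the mass $B_0$ at time $0$), and $V^{x,B,j}_t:=S^j_t\widehat V^j_t$, $j=1,\dots,d$. Admissibility and Bellman function. $B$ is admissible if $V^{x,B}_t\in K$ a.s. for every $t\in[0,T]$; $\mathcal{A}(x)$ is the class of admissible strategies in the given model. The Bellman function of the model is $u(x)=u(x,\mathbf{M}):=\sup_{B\in\mathcal{A}(x)}\mathbf{E}\,U(V^{x,B}_T)$, the expectation being under the probability measure of the model. *)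

(* Defs.v *)
From HB Require Import structures.
From mathcomp Require Import all_boot all_order all_algebra.
From mathcomp Require Import all_classical all_reals all_analysis.
From mathcomp Require Import measurable_realfun.

Set Implicit Arguments.
Unset Strict Implicit.
Unset Printing Implicit Defensive.

Import Order.TTheory GRing.Theory Num.Theory.
Import numFieldNormedType.Exports.

Local Open Scope classical_set_scope.
Local Open Scope ring_scope.

(* Time runs over [0, T]: a path is a function on R, and every notion below
   looks only at its values on [0, T]. *)

Definition borel_rV (R : realType) (n : nat) :=
  g_sigma_algebraType (@open 'rV[R]_n).

Section paths.
Context {R : realType} (T : R) {n : nat}.
Implicit Types (f : R -> 'rV[R]_n) (K : set 'rV[R]_n).

Definition rcll f :=
  (forall t, 0 <= t < T -> f x @[x --> t^'+] --> f t) /\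
  (forall t, 0 < t <= T -> cvg (f x @[x --> t^'-])).

Definition skorokhod_space : set (R -> 'rV[R]_n) := [set f | rcll f].

Definition opp_cone K : set 'rV[R]_n := [set - z | z in K].

Definition K_increasing K f :=
  forall s t, 0 <= s -> s <= t -> t <= T -> K (f t - f s).

Definition K_decreasing K f := K_increasing (opp_cone K) f.

Definition decreasing_paths K : set (R -> 'rV[R]_n) :=
  skorokhod_space `&` [set f | K_decreasing K f].

End paths.

Section cones.
Context {R : realType} {n : nat}.

Definition positive_orthant : set 'rV[R]_n := [set z | forall j, 0 < z 0 j].

Definition is_cone (K : set 'rV[R]_n) := forall a z, 0 <= a -> K z -> K (a *: z).

Record solvency_cone (K : set 'rV[R]_n) : Prop := SolvencyCone {
  solvency_closed : closed K ;
  solvency_convex : convex_set K ;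
  solvency_is_cone : is_cone K ;
  solvency_proper : K `&` opp_cone K = [set 0] ;
  solvency_positive : positive_orthant `<=` K }.

(* U is a total function, of which only the values on K matter. *)
Record utility (K : set 'rV[R]_n) (U : 'rV[R]_n -> \bar R) : Prop := Utility {
  utility_lty : forall z, K z -> (U z < +oo)%E ;
  utility_borel : measurable_fun (K : set (borel_rV R n)) U }.

End cones.

Section riemann_stieltjes.
Context {R : realType}.
Implicit Types (f g : R -> R) (a b : R).

(* [a :: s] are the division points, [xi i] is the tag of the i-th interval. *)
Definition RS_sum f g a (s : seq R) (xi : nat -> R) : R :=
  \sum_(i < size s)
    f (xi i) * (g (nth a (a :: s) i.+1) - g (nth a (a :: s) i)).

Definition tagged_partition a b (s : seq R) (xi : nat -> R) :=
  itv_partition a b s /\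
  forall i, (i < size s)%N ->
    nth a (a :: s) i <= xi i <= nth a (a :: s) i.+1.

Definition mesh_lt a (s : seq R) (delta : R) :=
  forall i, (i < size s)%N ->
    nth a (a :: s) i.+1 - nth a (a :: s) i < delta.

Definition is_RS_integral f g a b (I : R) :=
  forall e, 0 < e -> exists2 delta, 0 < delta &
    forall s xi, tagged_partition a b s xi -> mesh_lt a s delta ->
      `|RS_sum f g a s xi - I| < e.

(* The junk value 0 is taken only if the integral does not exist. *)
Definition RS_integral f g a b : R := xget 0 [set I | is_RS_integral f g a b I].

(* The integral over [0, t] with the convention g(0-) = 0: the integrator has
   the mass g 0 at time 0. *)
Definition RS_integral0 f g t : R := f 0 * g 0 + RS_integral f g 0 t.

End riemann_stieltjes.

Section independence.
Context {R : realType} {disp : measure_display} {Omega : measurableType disp}.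
Context (P : probability Omega R).

Definition mutually_independent {n m : nat} (X : 'I_n -> Omega -> 'rV[R]_m) :=
  forall A : 'I_n -> set (borel_rV R m), (forall i, measurable (A i)) ->
    P (\bigcap_(i in [set: 'I_n]) (X i @^-1` A i)) =
    (\prod_(i < n) P (X i @^-1` A i))%E.

(* The increment ending at the i-th time of the grid t; the first one starts
   at 0-, where the process is 0 by convention. *)
Definition increment {m : nat} (Y : R -> Omega -> 'rV[R]_m) (t : nat -> R)
    (i : nat) (w : Omega) : 'rV[R]_m :=
  if i is j.+1 then Y (t i) w - Y (t j) w else Y (t 0%N) w.

Definition independent_increments (T : R) {m : nat}
    (Y : R -> Omega -> 'rV[R]_m) :=
  forall (n : nat) (t : nat -> R),
    0 <= t 0%N -> (forall i, (i < n)%N -> t i < t i.+1) -> t n <= T ->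
    mutually_independent (fun i : 'I_n.+1 => increment Y t i).

(* The sigma-algebra generated by Y_s, s <= t, and the null sets of the
   underlying sigma-algebra. *)
Definition generated_filtration {m : nat} (Y : R -> Omega -> 'rV[R]_m) (t : R) :
    set (set Omega) :=
  <<s [set E | exists s (A : set (borel_rV R m)),
         [/\ 0 <= s <= t, measurable A & E = Y s @^-1` A]]
      `|` [set N | measurable N /\ P N = 0%E] >>.

End independence.

Definition adapted {R : realType} {Omega : Type} (T : R)
    (FF : R -> set (set Omega)) {m : nat} (X : R -> Omega -> 'rV[R]_m) :=
  forall t, 0 <= t <= T ->
    forall A : set (borel_rV R m), measurable A -> FF t (X t @^-1` A).

Record market_model (R : realType) (p d : nat) (T : R) := MarketModel {
  mm_disp : measure_display ;
  mm_space : measurableType mm_disp ;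
  mm_filtration : R -> set (set mm_space) ;
  mm_prob : probability mm_space R ;
  mm_Y : R -> mm_space -> 'rV[R]_p ;
  mm_S : R -> mm_space -> 'rV[R]_d ;
  mm_Y_measurable : forall t, 0 <= t <= T ->
    measurable_fun setT (mm_Y t : mm_space -> borel_rV R p) ;
  mm_Y_rcll : forall w, skorokhod_space T (mm_Y ^~ w) ;
  mm_filtrationE : forall t, 0 <= t <= T ->
    mm_filtration t = generated_filtration mm_prob mm_Y t ;
  mm_S_adapted : adapted T mm_filtration mm_S ;
  mm_S_pos : forall t w, 0 <= t <= T -> positive_orthant (mm_S t w) ;
  mm_S_continuous : forall w, {within `[0, T], continuous (mm_S ^~ w)} ;
  mm_S_initial : forall w, mm_S 0 w = const_mx 1 ;
  mm_S_numeraire : forall t w (j : 'I_d), 0 <= t <= T ->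
    nat_of_ord j = 0%N -> mm_S t w 0 j = 1 }.

Arguments mm_filtration {R p d T} m t.
Arguments mm_Y {R p d T} m t w.
Arguments mm_S {R p d T} m t w.

Section laws.
Context {R : realType} {p d : nat} {T : R}.

(* The sigma-algebra generated by the evaluations at times of [0, T]; its trace
   on the pairs of RCLL paths is the usual one on the Skorokhod spaces. *)
Definition cylinders : set (set ((R -> 'rV[R]_p) * (R -> 'rV[R]_d))) :=
  [set E | exists t (A : set (borel_rV R p)),
     [/\ 0 <= t <= T, measurable A & E = [set f | A (f.1 t)]]] `|`
  [set E | exists t (A : set (borel_rV R d)),
     [/\ 0 <= t <= T, measurable A & E = [set f | A (f.2 t)]]].

Definition path_space := g_sigma_algebraType cylinders.

Definition joint_path (M : market_model p d T) (w : mm_space M) : path_space :=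
  (mm_Y M ^~ w, mm_S M ^~ w).

Definition joint_law (M : market_model p d T) : set path_space -> \bar R :=
  pushforward (mm_prob M) (@joint_path M).

Definition same_law (M M' : market_model p d T) :=
  forall A : set path_space, measurable A -> joint_law M A = joint_law M' A.

End laws.

Section optimization.
Context {R : realType} {p d : nat} {T : R}.
Implicit Types (M : market_model p d T) (K : set 'rV[R]_d).
Implicit Types (U : 'rV[R]_d -> \bar R) (x : 'rV[R]_d).

Definition strategy M K (B : R -> mm_space M -> 'rV[R]_d) :=
  adapted T (mm_filtration M) B /\
  forall w, decreasing_paths T K (B ^~ w).

Definition discounted_wealth M x (B : R -> mm_space M -> 'rV[R]_d)
    (t : R) (w : mm_space M) : 'rV[R]_d :=
  \row_j (x 0 j +
    RS_integral0 (fun s => (mm_S M s w 0 j)^-1) (fun s => B s w 0 j) t).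

Definition wealth M x (B : R -> mm_space M -> 'rV[R]_d)
    (t : R) (w : mm_space M) : 'rV[R]_d :=
  \row_j (mm_S M t w 0 j * discounted_wealth x B t w 0 j).

Definition admissible M K x : set (R -> mm_space M -> 'rV[R]_d) :=
  [set B | strategy K B /\
    forall t, 0 <= t <= T -> {ae mm_prob M, forall w, K (wealth x B t w)}].
Arguments admissible : clear implicits.

(* The terminal wealth of an admissible strategy is in K, the domain of U,
   almost surely only. *)
Definition terminal_in M K x (B : R -> mm_space M -> 'rV[R]_d) :
    set (mm_space M) :=
  [set w | K (wealth x B T w)].

Definition expected_utility M K U x (B : R -> mm_space M -> 'rV[R]_d) : \bar R :=
  (\int[mm_prob M]_(w in terminal_in K x B) U (wealth x B T w))%E.

Definition expectations_defined M K U :=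
  forall x, K x -> forall B, admissible M K x B ->
    (\int[mm_prob M]_(w in terminal_in K x B) (U^\+ (wealth x B T w)) < +oo \/
     \int[mm_prob M]_(w in terminal_in K x B) (U^\- (wealth x B T w)) < +oo)%E.

Definition bellman M K U x : \bar R :=
  ereal_sup [set expected_utility K U x B | B in admissible M K x].

End optimization.
Arguments bellman {R p d T} M K U x.

(* Main.v *)
Require Import Defs.
From HB Require Import structures.
From mathcomp Require Import all_boot all_order all_algebra.
From mathcomp Require Import all_classical all_reals all_analysis.
From mathcomp Require Import measurable_realfun.
From mathcomp Require Import ring lra.
Import Order.TTheory GRing.Theory Num.Theory.
Import numFieldNormedType.Exports.
Local Open Scope classical_set_scope.
Local Open Scope ring_scope.

Set Implicit Arguments.
Unset Strict Implicit.
Unset Printing Implicit Defensive.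

(* A strategy B of the first model is adapted to the filtration of Y completed
   by null sets, so each B_t equals almost surely a measurable functional G_t
   of the path of Y up to time t. On a countable dense set of times G is
   almost surely K-decreasing; as K is proper, some linear form dominates all
   coordinates on K, so the coordinates of such a path are differences of
   monotone functions and have right limits. The right limits give a
   functional beta of the path with values in the K-decreasing RCLL paths,
   with beta_t = G_t and beta_t = B_t almost surely for every t. Applied to
   the path of the second model, beta is a strategy there: it is adapted
   because beta_t = G_t almost surely depends only on the law. The same
   decomposition makes the Riemann-Stieltjes integrals exist, so that the
   wealth is a limit of Riemann sums, hence the same measurable functional of
   the paths in both models: admissibility and expected utility are
   preserved. *)

(** * A linear form dominating the coordinates on a proper cone *)

Section positive_functional.
Context {R : realType} {n : nat}.
Implicit Types (K : set 'rV[R]_n) (u v w z : 'rV[R]_n).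

Definition dot u v : R := \sum_j u 0 j * v 0 j.

Lemma dotDl u v w : dot (u + v) w = dot u w + dot v w.
Proof. by rewrite -big_split; apply: eq_bigr => j _; rewrite mxE mulrDl. Qed.

Lemma dotC u v : dot u v = dot v u.
Proof. by apply: eq_bigr => j _; rewrite mulrC. Qed.

Lemma dotDr u v w : dot w (u + v) = dot w u + dot w v.
Proof. by rewrite dotC dotDl !(dotC w). Qed.

Lemma dotZl a u v : dot (a *: u) v = a * dot u v.
Proof. by rewrite mulr_sumr; apply: eq_bigr => j _; rewrite mxE mulrA. Qed.

Lemma dotZr a u v : dot u (a *: v) = a * dot u v.
Proof. by rewrite dotC dotZl dotC. Qed.

Lemma dotNr u v : dot u (- v) = - dot u v.
Proof. by rewrite -scaleN1r dotZr mulN1r. Qed.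

Lemma dotBr u v w : dot w (u - v) = dot w u - dot w v.
Proof. by rewrite dotDr dotNr. Qed.

Lemma dot0r u : dot u 0 = 0.
Proof. by apply: big1 => j _; rewrite mxE mulr0. Qed.

Lemma dot_ge0 u : 0 <= dot u u.
Proof. by apply: sumr_ge0 => j _; rewrite -expr2 sqr_ge0. Qed.

Lemma coord_sqr_le_dot u j : (u 0 j) ^+ 2 <= dot u u.
Proof.
by rewrite /dot (bigD1 j)//= expr2 lerDl; apply: sumr_ge0 => k _;
  rewrite -expr2 sqr_ge0.
Qed.

Lemma dot_eq0 u : dot u u = 0 -> u = 0.
Proof.
move=> u0; apply/rowP => j; rewrite mxE; apply/eqP; rewrite -sqrf_eq0.
by rewrite eq_le sqr_ge0 andbT -u0 coord_sqr_le_dot.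
Qed.

Lemma dot_continuous v : continuous (dot v).
Proof.
apply: (continuous_big (P := xpredT) add_continuous) => j _ z.
exact: (continuousM (@cst_continuous _ _ (v 0 j) z)
                    (@coord_continuous R 1 n 0 j z)).
Qed.

Lemma normsqr_continuous v : continuous (fun z => dot (z + v) (z + v)).
Proof.
apply: (continuous_big (P := xpredT) add_continuous) => j _ z.
have cj : {for z, continuous (fun x : 'rV[R]_n => (x + v) 0 j)}.
  have -> : (fun x : 'rV[R]_n => (x + v) 0 j) = (fun x => x 0 j + v 0 j).
    by apply/funext => x; rewrite mxE.
  exact: (continuousD (@coord_continuous R 1 n 0 j z)
                      (@cst_continuous _ _ (v 0 j) z)).
exact: (continuousM cj cj).
Qed.

Lemma coord_le_norm u j : `|u 0 j| <= `|u|.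
Proof.
by rewrite [leRHS]/Num.norm /= mx_normrE;
  apply: (le_bigmax_cond _ (fun i => `|u i.1 i.2|) (isT : xpredT (0, j))).
Qed.

Lemma norm_rV_lt u a : 0 < a -> (forall j, `|u 0 j| < a) -> `|u| < a.
Proof.
move=> a0 ua; rewrite [ltLHS]/Num.norm /= mx_normrE; apply/bigmax_ltP; split => //.
by move=> -[i j] _ /=; rewrite (ord1 i).
Qed.

(** The points of [K] no farther from [- u] than 0 form a closed bounded set, on which the minimum
    is attained. *)
Lemma closest_point K u : closed K -> K 0 ->
  exists2 q, K q & forall z, K z -> dot (q + u) (q + u) <= dot (z + u) (z + u).
Proof.
move=> cK K0; pose N := fun z => dot (z + u) (z + u).
pose A := K `&` [set z | N z <= N 0].
have A0 : A 0 by split => //=.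
have cA : closed A.
  apply: closedI => //; apply: (@preimage_closed _ _ N [set y | y <= N 0]).
    by move=> z _; exact: normsqr_continuous.
  exact: closed_le.
have bA : bounded_set A.
  (* Each coordinate of [z + u] has square at most [N 0 < (1 + N 0) ^+ 2], so [1 + N 0] bounds it
     without a square root. *)
  exists (1 + N 0 + `|u|); split; first exact: num_real.
  move=> M hM z [_ /= zN]; apply/ltW/(lt_trans _ hM).
  have N0 : 0 <= N 0 by exact: dot_ge0.
  rewrite -[z](addrK u); apply: le_lt_trans (ler_normB _ _) _; rewrite ltrD2r.
  apply: norm_rV_lt => [|j]; first by rewrite ltr_wpDr.
  have := le_trans (coord_sqr_le_dot (z + u) j) zN.
  rewrite -real_normK ?num_real//; set b := `|_| => bN.
  rewrite ltNge; apply/negP => Nb.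
  suff : b ^+ 2 > N 0 by rewrite ltNge bN.
  nra.
have [q qA qmin] := @EVT_min_rV R n N A (ex_intro _ _ A0)
  (bounded_closed_compact bA cA) (continuous_subspaceT (@normsqr_continuous u)).
rewrite inE in qA; exists q; first by case: qA.
move=> z Kz; have [zN|/ltW Nz] := leP (N z) (N 0).
  by apply: qmin; rewrite inE.
by apply: le_trans Nz; case: qA.
Qed.

Lemma cone_addr K : convex_set K -> is_cone K ->
  forall y z, K y -> K z -> K (y + z).
Proof.
move=> vK oK y z Ky Kz.
have h0 : 0 <= 2^-1 :> R by lra.
have h1 : 2^-1 <= 1 :> R by lra.
have /set_mem Kyz := vK y z (Itv01 h0 h1) (mem_set Ky) (mem_set Kz).
have := oK 2 _ (ler0n _ _) Kyz; congr (K _).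
change (2 *: ((2^-1 : R) *: y + (1 - 2^-1) *: z) = y + z).
rewrite scalerDr !scalerA mulfV ?pnatr_eq0// scale1r.
by rewrite (_ : 2 * (1 - 2^-1) = 1 :> R) ?scale1r//; lra.
Qed.

(** Let [q] be the point of [K] closest to [- u] and [v = q + u]. Optimality in the directions of
    [K] makes [v] nonnegative on [K]; optimality in the direction [- q] gives [dot v u >= dot v v],
    which is positive since [q = - u] would put [u] in [K] and [- K]. *)
Lemma dual_separation K u : closed K -> convex_set K -> is_cone K ->
  K `&` opp_cone K = [set 0] -> K u -> u != 0 ->
  exists2 v, (forall z, K z -> 0 <= dot v z) & 0 < dot v u.
Proof.
move=> cK vK oK pK Ku u0.
have KD := cone_addr vK oK.
have K0 : K 0 by rewrite -(scale0r u); exact: oK.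
have [q Kq qmin] := closest_point u cK K0.
(* First-order optimality of [q] in the direction [z]. *)
have opt z e0 : 0 < e0 -> (forall e, 0 < e < e0 -> K (q + e *: z)) ->
    0 <= dot (q + u) z.
  move=> e0_gt0 Kz; rewrite leNgt; apply/negP => zlt0.
  set c := dot (q + u) z in zlt0.
  pose N := dot z z; have N0 : 0 <= N := dot_ge0 z.
  (* With [e * (N + 1) <= - c] the change [e * (2 * c + e * N)] of the squared distance is negative,
     against the minimality of [q]. *)
  pose e := Num.min (e0 / 2) (- c / (N + 1)).
  have e_gt0 : 0 < e by rewrite /e lt_min !divr_gt0 ?oppr_gt0//= ltr_wpDl.
  have ee0 : e < e0 by rewrite /e gt_min; apply/orP; left; lra.
  have eN : e * (N + 1) <= - c.
    by rewrite -ler_pdivlMr ?ltr_wpDl// /e ge_min lexx orbT.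
  have := qmin _ (Kz e _); rewrite e_gt0 ee0 => /(_ isT).
  have -> : q + e *: z + u = (q + u) + e *: z by rewrite addrAC.
  have -> y : dot (y + e *: z) (y + e *: z) =
      dot y y + e * (2 * dot y z + e * dot z z).
    by rewrite dotDl !dotDr !dotZr !dotZl (dotC z); ring.
  by rewrite -/c -/N; nra.
exists (q + u) => [z Kz|].
  by apply: (opt _ 1) => // e /andP[e0 _]; apply: KD => //; exact/oK/Kz/ltW.
have qle : 0 <= dot (q + u) (- q).
  apply: (opt _ 1) => // e /andP[e0 e1].
  rewrite scalerN -{1}[q]scale1r -scalerBl; apply: oK => //; lra.
have : 0 < dot (q + u) (q + u).
  rewrite lt0r dot_ge0 andbT; apply: contra u0 => /eqP /dot_eq0 qu0.
  have : (K `&` opp_cone K) u.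
    by split => //; exists q => //; apply/eqP; rewrite eq_sym -addr_eq0 addrC qu0.
  by rewrite pK => ->.
by move: qle; rewrite dotNr (dotDr q u); lra.
Qed.

(** A dual vector positive at a unit vector of [K] is positive nearby. By compactness finitely many
    of them cover the unit vectors of [K], and their sum has a positive minimum there. Divided by
    it, the sum dominates the norm, hence each coordinate. *)
Lemma cone_positive_functional K : closed K -> convex_set K -> is_cone K ->
  K `&` opp_cone K = [set 0] ->
  exists v, forall z j, K z -> `|z 0 j| <= dot v z.
Proof.
move=> cK vK oK pK; pose S := K `&` [set z | `|z| = 1].
have [S0|/set0P S0] := eqVneq S set0.
  (* Without unit vectors, [K] contains no nonzero vector. *)
  exists 0 => z j Kz; have [->|z0] := eqVneq z 0.
    by rewrite mxE normr0 dot_ge0.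
  suff : S (`|z|^-1 *: z) by rewrite S0.
  split; first exact: oK.
  by rewrite /= normrZ normfV normr_id mulVf// normr_eq0.
have cS : compact S.
  apply: bounded_closed_compact.
    by exists 1; split => // M M1 z [_ /= ->]; exact: ltW.
  apply: closedI => //.
  apply: (@preimage_closed _ _ (fun z : 'rV[R]_n => `|z|) [set y | y = 1]).
    by move=> z _; exact: norm_continuous.
  exact: closed_eq.
have := cS; rewrite compact_cover => /(_ _ [set v | forall z, K z -> 0 <= dot v z]
  (fun v => [set z | 0 < dot v z])) [|z [Kz z1]|F FD SF].
- move=> v _; apply: (@open_comp _ _ (dot v) [set y | 0 < y]).
    by move=> z _; exact: dot_continuous.
  exact: open_gt.
- have zn0 : z != 0 by rewrite -normr_gt0 z1.
  by have [v v0 vz] := dual_separation cK vK oK pK Kz zn0; exists v.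
pose s : seq 'rV[R]_n := finmap.enum_fset F.
have sK v : v \in s -> forall z, K z -> 0 <= dot v z.
  by move=> vs; have := FD v vs; rewrite inE.
pose w := \sum_(v <- s) v.
have dotw z : dot w z = \sum_(v <- s) dot v z.
  by rewrite /w; elim/big_rec2: _ => [|v a b _ <-]; rewrite ?dotDl// dotC dot0r.
have wS z : S z -> 0 < dot w z.
  move=> /[dup] -[Kz _] /SF[v /= vF vz].
  rewrite dotw (big_rem v)//= ltr_pwDl// big_seq; apply: sumr_ge0 => u /mem_rem us.
  exact: sK.
have [z0 z0S zmin] := @EVT_min_rV R n (dot w) S S0 cS
  (continuous_subspaceT (@dot_continuous w)).
rewrite inE in z0S; have c0 := wS _ z0S.
exists ((dot w z0)^-1 *: w) => z j Kz; apply: le_trans (coord_le_norm z j) _.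
have [->|zn0] := eqVneq z 0; first by rewrite normr0 dot0r.
have Sz : S (`|z|^-1 *: z).
  by split; [exact: oK|rewrite /= normrZ normfV normr_id mulVf// normr_eq0].
rewrite dotZl mulrC ler_pdivlMr// mulrC -ler_pdivlMr ?normr_gt0//.
by rewrite mulrC -dotZr; apply: zmin; rewrite inE.
Qed.

End positive_functional.

(** * Riemann-Stieltjes integrals *)

Section riemann_stieltjes_existence.
Context {R : realType}.
Implicit Types (f g : R -> R) (a b c e : R) (s : seq R) (xi : nat -> R).

(** Heine-Cantor, from compactness in near-covering form: it is enough to find, near each point,
    that all small [delta] work. *)
Lemma uniform_continuity_itv f a b e :
  {within `[a, b], continuous f} -> 0 < e ->
  exists2 delta, 0 < delta & forall x y, a <= x <= b -> a <= y <= b ->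
    `|x - y| < delta -> `|f x - f y| < e.
Proof.
move=> cf e0.
have /compact_near_coveringP/near_covering_withinP := @segment_compact R a b.
move=> cov.
have H : \forall delta \near 0^'+, `[a, b] `<=` (fun x => forall y,
    a <= y <= b -> `|x - y| < delta -> `|f x - f y| < e).
  apply: cov => x xab.
  have : f z @[z --> within `[a, b] (nbhs x)] --> f x.
    by have := cf x; rewrite nbhs_subspace_in.
  have e20 : 0 < e / 2 by rewrite divr_gt0.
  move=> /cvgrPdist_lt/(_ _ e20) /nbhs_ballP[eta /= eta0 Heta].
  near=> x' delta => /= x'ab y yab x'y.
  have x'x : ball x (eta / 2) x'.
    by near: x'; apply: nbhsx_ballx; rewrite divr_gt0.
  have deta : delta < eta / 2.
    by near: delta; apply: nbhs_right_lt; rewrite divr_gt0.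
  have H1 : `|f x - f x'| < e / 2.
    by apply: Heta => //; apply: le_ball x'x; lra.
  have H2 : `|f x - f y| < e / 2.
    apply: Heta => //; rewrite /ball/= -(subrKA x').
    by move: x'x; rewrite /ball/= => x'x; rewrite (le_lt_trans (ler_normD _ _))//; lra.
  rewrite -(subrKA (f x)) (le_lt_trans (ler_normD _ _))// distrC; lra.
near (0 : R)^'+ => delta.
have d0 : 0 < delta by near: delta; exact: nbhs_right_gt.
have Hd : `[a, b] `<=` (fun x => forall y, a <= y <= b ->
    `|x - y| < delta -> `|f x - f y| < e) by near: delta; exact: H.
by exists delta => // x y xab; exact: Hd.
Unshelve. all: end_near.
Qed.

(** [J x y] is the Lebesgue-Stieltjes integral of [f] over []x, y]]: half-open intervals have mass
    exactly [G y - G x] and split without overlap. Only additivity and the estimate on one cell are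
    passed on to the Riemann-Stieltjes argument. *)
Lemma additive_integral (G : cumulative R R) f a b :
  {within `[a, b], continuous f} ->
  exists2 J : R -> R -> R,
    (forall x y z, a <= x -> x <= y -> y <= z -> z <= b ->
      J x z = J x y + J y z) &
    forall x y (c e : R), a <= x -> x <= y -> y <= b ->
      (forall u, x < u <= y -> `|c - f u| <= e) ->
      `|c * (G y - G x) - J x y| <= e * (G y - G x).
Proof.
move=> cf.
pose mu : {measure set (measurableTypeR R) -> \bar R} := lebesgue_stieltjes_measure G.
have muE x y : x <= y -> mu `]x, y]%classic = (G y - G x)%:E.
  move=> xy; rewrite /mu /= /lebesgue_stieltjes_measure/= /measure_extension/=.
  rewrite measurable_mu_extE//; last exact: is_ocitv.
  exact: wlength_itv_bnd.
have intf x y : a <= x -> x <= y -> y <= b ->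
    mu.-integrable `]x, y]%classic (EFin \o f).
  move=> ax xy yb.
  have sub : `]x, y] `<=` `[a, b].
    by move=> u /=; rewrite !in_itv/= => /andP[? ?]; apply/andP; split; lra.
  apply: measurable_bounded_integrable => //.
  - by rewrite muE// ltry.
  - apply: (@measurable_funS _ _ _ _ `[a, b]%classic) => //.
    exact: subspace_continuous_measurable_fun.
  - have /compact_bounded[M [Mr fM]] :=
      continuous_compact cf (@segment_compact R a b).
    by exists M; split => // r Mltr u /sub uab; apply: (fM r Mltr); exists u.
have icst r x y : x <= y -> mu.-integrable `]x, y]%classic (EFin \o (fun=> r)).
  move=> xy; apply: measurable_bounded_integrable => //.
  - by rewrite muE// ltry.
  - by exists `|r|; split => // M /ltW rM u _ /=.
exists (fun x y => \int[mu]_(u in `]x, y]%classic) f u).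
  move=> x y z ax xy yz zb.
  have xyz : `]x, z]%classic = `]x, y]%classic `|` `]y, z]%classic.
    apply/seteqP; split => u /=; rewrite !in_itv/=.
      by move=> /andP[xu uz]; have [uy|yu] := leP u y; [left|right]; rewrite ?xu ?uy.
    by move=> [|] /andP[? ?]; apply/andP; split; lra.
  rewrite -Rintegral_setU//; first by rewrite xyz.
    by rewrite -xyz; apply: intf => //; exact: le_trans yz.
  apply/disj_setPS => u [] /=; rewrite !in_itv/= => /andP[_ uy] /andP[yu _].
  by move: uy; rewrite leNgt yu.
move=> x y c e ax xy yb ce.
have -> : c * (G y - G x) = \int[mu]_(u in `]x, y]%classic) c.
  by rewrite Rintegral_cst// muE.
have -> : e * (G y - G x) = \int[mu]_(u in `]x, y]%classic) e.
  by rewrite Rintegral_cst// muE.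
have icf : mu.-integrable `]x, y]%classic (EFin \o (fun u => c - f u)).
  have -> : EFin \o (fun u => c - f u) = ((EFin \o (fun=> c)) \- (EFin \o f))%E.
    by apply/funext.
  by apply: integrableB => //; [exact: icst|exact: intf].
rewrite -RintegralB//; [|exact: icst|exact: intf].
apply: le_trans (le_normr_Rintegral _ _) _ => //.
apply: le_Rintegral => //; [|exact: icst].
rewrite (_ : EFin \o _ = abse \o (EFin \o (fun u => c - f u)))//.
exact: integrable_abse.
Qed.

Lemma RS_sum_cons f g a c s xi : RS_sum f g a (c :: s) xi =
  f (xi 0%N) * (g c - g a) + RS_sum f g c s (xi \o S).
Proof.
rewrite /RS_sum /= big_ord_recl /=; congr (_ + _); apply: eq_bigr => i _.
rewrite /bump /= !add1n /=; congr (_ * (g _ - g _)).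
  by apply: set_nth_default; exact: ltn_ord.
by rewrite add0n; apply: set_nth_default; rewrite /= ltnS ltnW.
Qed.

(** Additivity cuts [J a b] along the partition, and the error bounds of the cells, proportional to
    the increments of [g], telescope. *)
Lemma RS_sum_additive (J : R -> R -> R) f g a b e s xi :
  (forall x y z, a <= x -> x <= y -> y <= z -> z <= b ->
    J x z = J x y + J y z) ->
  itv_partition a b s ->
  (forall i, (i < size s)%N ->
    `|f (xi i) * (g (nth a (a :: s) i.+1) - g (nth a (a :: s) i)) -
      J (nth a (a :: s) i) (nth a (a :: s) i.+1)|
    <= e * (g (nth a (a :: s) i.+1) - g (nth a (a :: s) i))) ->
  `|RS_sum f g a s xi - J a b| <= e * (g b - g a).
Proof.
elim: s a xi => [|c s IH] a xi Jadd part Jle.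
  have ab := itv_partition_nil part; subst b.
  have Jaa := Jadd a a a (lexx _) (lexx _) (lexx _) (lexx _).
  have -> : J a a = 0 by lra.
  by rewrite /RS_sum big_ord0 !subrr normr0 mulr0.
have part' := itv_partition_cons part.
have ac : a <= c by case: part => /= /andP[/ltW].
have cb := itv_partition_le part'.
rewrite RS_sum_cons (Jadd a c b)//.
have := Jle 0%N isT; rewrite /= => J0.
have := IH c (xi \o S); move=> /(_ _ part' _)/wrap[].
  by move=> x y z cx; apply: Jadd; exact: le_trans cx.
  move=> i si; have := Jle i.+1 si; rewrite /= (set_nth_default c a)//.
  by rewrite (set_nth_default c a _ : nth a (c :: s) i = nth c (c :: s) i)//= ltnS ltnW.
move=> IHc; rewrite opprD addrACA (le_trans (ler_normD _ _))//; lra.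
Qed.

Lemma is_RS_integral_cumulative (G : cumulative R R) f a b : a <= b ->
  {within `[a, b], continuous f} -> exists I, is_RS_integral f G a b I.
Proof.
move=> ab cf; have [J Jadd Jle] := additive_integral G cf.
exists (J a b) => e e0.
have GE : 0 <= G b - G a by rewrite subr_ge0 cumulative_is_nondecreasing.
(* The [+ 1] keeps the denominator positive when [G b = G a]. *)
pose e' := e / (G b - G a + 1).
have e'0 : 0 < e' by rewrite divr_gt0// ltr_wpDl.
have [delta d0 fd] := uniform_continuity_itv cf e'0.
exists delta => // s xi [part tag] mesh.
have := @RS_sum_additive J f G a b e' s xi Jadd part; move=> /(_ _)/wrap[].
  move=> i si; have /andP[t1 t2] := tag i si.
  have ge1 : a <= nth a (a :: s) i.
    by rewrite (set_nth_default b)//= ?(itv_partition_nth_ge _ part)// ltnS ltnW.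
  have le2 : nth a (a :: s) i.+1 <= b.
    by rewrite (set_nth_default b)//= (itv_partition_nth_le (m := i.+1) _ part).
  apply: Jle => // [|u /andP[xu uy]]; first exact: le_trans t2.
  apply/ltW/fd; [apply/andP; split; lra|apply/andP; split; lra|].
  have := mesh i si; rewrite ltr_norml => ?; apply/andP; split; lra.
move=> H; apply: le_lt_trans H _; rewrite /e' mulrAC ltr_pdivrMr ?ltr_wpDl//.
by rewrite ltr_pM2l// ltrDl.
Qed.

Lemma eq_is_RS_integral f g g' a b I :
  (forall t, a <= t <= b -> g t = g' t) ->
  is_RS_integral f g a b I -> is_RS_integral f g' a b I.
Proof.
move=> gg' fgI e e0; have [delta d0 fgI_lt] := fgI e e0.
exists delta => // s xi [part tag] mesh.
suff <- : RS_sum f g a s xi = RS_sum f g' a s xi by exact: fgI_lt.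
have nth_itv i : (i <= size s)%N -> a <= nth a (a :: s) i <= b.
  move=> si; rewrite (set_nth_default b)//.
  by rewrite (itv_partition_nth_ge _ part)//= (itv_partition_nth_le _ part).
apply: eq_bigr => -[i si] _; congr (_ * (_ - _)); apply: gg'.
  exact: (nth_itv i.+1).
by apply: nth_itv; exact: ltnW.
Qed.

Lemma is_RS_integralB f g g' a b I I' :
  is_RS_integral f g a b I -> is_RS_integral f g' a b I' ->
  is_RS_integral f (g \- g') a b (I - I').
Proof.
move=> fgI fgI' e e0; have e20 : 0 < e / 2 by rewrite divr_gt0.
have [d d0 H] := fgI _ e20; have [d' d'0 H'] := fgI' _ e20.
exists (Num.min d d') => [|s xi part mesh]; first by rewrite lt_min d0.
have -> : RS_sum f (g \- g') a s xi = RS_sum f g a s xi - RS_sum f g' a s xi.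
  by rewrite /RS_sum -sumrB; apply: eq_bigr => i _ /=; ring.
have : `|RS_sum f g a s xi - I| < e / 2.
  by apply: H => // i si; have := mesh i si; rewrite lt_min => /andP[].
have : `|RS_sum f g' a s xi - I'| < e / 2.
  by apply: H' => // i si; have := mesh i si; rewrite lt_min => /andP[].
rewrite !ltr_norml => /andP[? ?] /andP[? ?]; apply/andP; split; lra.
Qed.

Lemma is_RS_integral_nondecreasing f g a b : a <= b ->
  {within `[a, b], continuous f} ->
  (forall u v, a <= u -> u <= v -> v <= b -> g u <= g v) ->
  (forall t, a <= t < b -> g x @[x --> t^'+] --> g t) ->
  exists I, is_RS_integral f g a b I.
Proof.
(* Clamping the argument to [[a, b]] extends [g] to a nondecreasing right-continuous function on the
   line, as a Stieltjes measure requires, and keeps the values on [[a, b]]. *)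
move=> ab cf gnd grc; pose G x := g (Num.max a (Num.min x b)).
have Gg t : a <= t <= b -> G t = g t.
  by move=> /andP[at_ tb]; rewrite /G min_l// max_r.
have Gnd : nondecreasing G.
  move=> x y xy; apply: gnd; first by rewrite le_max lexx.
    by rewrite ge_max !le_max lexx/= le_min !ge_min xy lexx !orbT.
  by rewrite ge_max ab ge_min lexx orbT.
have Grc : right_continuous G.
  move=> x; have [xa|ax] := ltP x a.
    have -> : G x = g a by rewrite /G max_l// ge_min (ltW xa).
    apply: cvg_near_cst; near=> y; rewrite /G max_l// ge_min; apply/orP; left.
    by near: y; apply: nbhs_right_le.
  have [xb|bx] := ltP x b.
    rewrite Gg; last by rewrite ax ltW.
    have := grc x; rewrite ax xb => /(_ isT); apply: cvg_trans.
    apply: near_eq_cvg; near=> y; rewrite Gg//; apply/andP; split.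
      by apply: (le_trans ax); near: y; exact: nbhs_right_ge.
    by near: y; exact: nbhs_right_le.
  have bG y : b <= y -> G y = g b by move=> yb; rewrite /G min_r// max_r.
  rewrite bG//; apply: cvg_near_cst; near=> y; rewrite bG//.
  by apply: (le_trans bx); near: y; exact: nbhs_right_ge.
pose Gc : cumulative R R := HB.pack G (isCumulative.Build R _ R G Gnd Grc).
have [I fGI] := is_RS_integral_cumulative Gc ab cf.
by exists I; exact: eq_is_RS_integral fGI.
Unshelve. all: by end_near. Qed.

(** Grid [n] has [n.+1] cells, so that the denominator is never 0. *)
Definition grid t n i : R := t * i%:R / n.+1%:R.

Lemma grid_itv t n i : 0 <= t -> (i <= n.+1)%N -> 0 <= grid t n i <= t.
Proof.
move=> t0 ni; rewrite /grid; apply/andP; split.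
  by rewrite divr_ge0// mulr_ge0.
by rewrite ler_pdivrMr// ler_wpM2l// ler_nat.
Qed.

Definition uniform_sum f g t n : R :=
  \sum_(i < n.+1) f (grid t n i) * (g (grid t n i.+1) - g (grid t n i)).

(** The mesh of the uniform grids tends to 0. Writing the integral as a limit of a sequence is what
    later makes it measurable in the path. *)
Lemma is_RS_integral_cvg f g t I : 0 <= t -> is_RS_integral f g 0 t I ->
  uniform_sum f g t n @[n --> \oo] --> I.
Proof.
rewrite le0r => /predU1P[->|t0] fgI.
  (* At [t = 0] the grid points coincide and form no strict partition; the empty partition forces
     the integral to be 0. *)
  have -> : I = 0.
    apply/eqP; rewrite -normr_eq0 eq_le normr_ge0 andbT.
    apply/ler_addgt0Pl => e e0; rewrite addr0.
    have [d d0] := fgI e e0; move=> /(_ [::] (fun=> 0)).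
    rewrite /RS_sum big_ord0 sub0r normrN.
    by move=> H; apply/ltW/H => //; split.
  apply: cvg_near_cst; apply: nearW => n.
  by apply: big1 => i _; rewrite /grid !mul0r subrr mulr0.
apply/cvgrPdist_lt => e e0; have [d d0 H] := fgI e e0.
near=> n.
pose s := mkseq (fun i => grid t n i.+1) n.+1.
have nths i : (i <= n.+1)%N -> nth 0 (0 :: s) i = grid t n i.
  by case: i => [|i] ni /=; rewrite ?nth_mkseq// /grid mulr0 mul0r.
have step i : grid t n i.+1 - grid t n i = t / n.+1%:R.
  by rewrite /grid -mulrBl -mulrBr -natrB// subSnn mulr1.
have step0 : 0 < t / n.+1%:R by rewrite divr_gt0.
have -> : uniform_sum f g t n = RS_sum f g 0 s (grid t n).
  rewrite /RS_sum /uniform_sum size_mkseq; apply: eq_bigr => i _.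
  by rewrite !nths// ltnW.
rewrite distrC; apply: H.
  split; [split|].
  - apply/(pathP 0) => i; rewrite size_mkseq => ni.
    rewrite (nths i (ltnW ni)) (nths i.+1 ni : nth 0 s i = _).
    by rewrite -subr_gt0 step.
  - by rewrite (last_nth 0) size_mkseq nths ?leqnn// /grid mulfK// pnatr_eq0.
  move=> i; rewrite size_mkseq => ni; rewrite (nths i (ltnW ni)) (nths i.+1 ni) lexx/=.
  by rewrite -subr_ge0 step ltW.
move=> i; rewrite size_mkseq => ni; rewrite (nths i (ltnW ni)) (nths i.+1 ni) step.
rewrite ltr_pdivrMr// mulrC -ltr_pdivrMr//.
have tdn : t / d < n%:R by near: n; exact: nbhs_infty_gtr.
by rewrite (lt_le_trans tdn)// ler_nat.
Unshelve. all: by end_near. Qed.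

End riemann_stieltjes_existence.

(** * Right limits of monotone paths *)

Section right_limits.
Context {R : realType} {T : R}.
Hypothesis T_gt0 : 0 < T.
Implicit Types (h : R -> R) (t : R).

(** These are the rational multiples of [T] in [[0, T]]. The cap on the index lets quantifiers over
    them run over all pairs of naturals. *)
Definition rational_time (k i : nat) : R := grid T k (minn i k.+1).

(** For [0 <= t < T] this is the first point of grid [k] strictly after [t]; at [t = T] the cap
    gives [T]. *)
Definition right_time t (k : nat) : R :=
  rational_time k (Num.truncn (t / T * k.+1%:R)).+1.

Lemma rational_time_itv k i : 0 <= rational_time k i <= T.
Proof. by apply: grid_itv; [exact: ltW|rewrite geq_minr]. Qed.

Lemma right_time_itv t k : 0 <= right_time t k <= T.
Proof. exact: rational_time_itv. Qed.

Lemma right_index_ge0 t k : 0 <= t -> 0 <= t / T * k.+1%:R.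
Proof. by move=> t0; rewrite mulr_ge0// divr_ge0// ltW. Qed.

Lemma right_time_homo s t k : s <= t -> right_time s k <= right_time t k.
Proof.
move=> st; rewrite /right_time /rational_time /grid.
rewrite ler_pM2r ?invr_gt0// ler_pM2l// ler_nat leq_min geq_minr andbT.
rewrite geq_min; apply/orP; left; rewrite ltnS; apply: le_truncn.
by rewrite ler_pM2r// ler_pM2r// invr_gt0.
Qed.

Lemma right_timeT k : right_time T k = T.
Proof.
rewrite /right_time /rational_time divff ?gt_eqF// mul1r natrK.
by rewrite (minn_idPr _)// /grid mulfK// pnatr_eq0.
Qed.

Lemma right_time_gt t k : 0 <= t < T -> t < right_time t k.
Proof.
move=> /andP[t0 tT]; rewrite /right_time /rational_time /grid.
rewrite ltr_pdivlMr// -ltr_pdivrMl// mulrA [T^-1 * t]mulrC natr_min lt_min.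
apply/andP; split.
  by have /andP[] := truncn_itv (right_index_ge0 k t0).
by rewrite gtr_pMl// ltr_pdivrMr// mul1r.
Qed.

Lemma right_time_cvg t : 0 <= t <= T -> right_time t k @[k --> \oo] --> t.
Proof.
move=> /andP[t0]; rewrite le_eqVlt => /predU1P[->|tT].
  by under eq_fun do rewrite right_timeT; exact: cvg_cst.
apply/cvgrPdist_lt => e e0; near=> k.
have tk : t < right_time t k by apply: right_time_gt; rewrite t0.
rewrite ltr0_norm ?subr_lt0// opprB ltrBlDr.
have : right_time t k <= t + T / k.+1%:R.
  rewrite /right_time /rational_time /grid natr_min.
  have /andP[le_x _] := truncn_itv (right_index_ge0 k t0).
  have -> : t + T / k.+1%:R = T * (t / T * k.+1%:R + 1) / k.+1%:R.
    have : k.+1%:R != 0 :> R by rewrite pnatr_eq0.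
    have : T != 0 by rewrite gt_eqF.
    by move: (k.+1%:R) => m T0 m0; field; rewrite T0 m0.
  by rewrite ler_pM2r ?invr_gt0// ler_pM2l// ge_min -natr1 lerD2r le_x.
move=> /le_lt_trans; apply; rewrite addrC ltrD2r ltr_pdivrMr// mulrC -ltr_pdivrMr//.
have tdn : T / e < k%:R by near: k; exact: nbhs_infty_gtr.
by rewrite (lt_le_trans tdn)// ler_nat.
Unshelve. all: by end_near. Qed.

(** For [h] monotone along the rational times, the infimum over later ones is the right limit along
    them. The alternative [r = T] keeps the set nonempty at [t = T] and makes the value there
    [h T]. *)
Definition right_limit h t : R :=
  inf [set h r | r in [set r | (exists k i, r = rational_time k i) /\
                               (t < r \/ r = T)]].

Section monotone.
Variable h : R -> R.
Hypothesis hnd : forall k i k' i', rational_time k i <= rational_time k' i' ->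
  h (rational_time k i) <= h (rational_time k' i').

Lemma rational_time0 : rational_time 0 0 = 0.
Proof. by rewrite /rational_time /grid mulr0 mul0r. Qed.

Lemma rational_timeT : exists k i, T = rational_time k i.
Proof. by exists 0%N; eexists; rewrite -[LHS](right_timeT 0). Qed.

Lemma right_limit_lbound t : has_lbound [set h r |
  r in [set r | (exists k i, r = rational_time k i) /\ (t < r \/ r = T)]].
Proof.
exists (h (rational_time 0 0)) => _ [_ [[k [i ->]] _] <-]; apply: hnd.
by rewrite rational_time0; case/andP: (rational_time_itv k i).
Qed.

Lemma right_limit_le t k i : t < rational_time k i ->
  right_limit h t <= h (rational_time k i).
Proof.
move=> tr; apply: ge_inf; first exact: right_limit_lbound.
by exists (rational_time k i) => //; split; [exists k, i|left].
Qed.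

Lemma right_limitT : right_limit h T = h T.
Proof.
rewrite /right_limit (_ : [set _ | _ in _] = [set h T]) ?inf1//.
apply/seteqP; split => [_ [_ [[k [i ->]] [Tr|->]] <-]|_ ->] //.
  by have /andP[_] := rational_time_itv k i; rewrite leNgt Tr.
by exists T => //; split; [exact: rational_timeT|right].
Qed.

Lemma right_limit_adherent t e : t < T -> 0 < e -> exists k i,
  t < rational_time k i /\ h (rational_time k i) < right_limit h t + e.
Proof.
move=> tT e0; have [|_ [r [[k [i rE]] tr] <-] hr] := inf_adherent e0 (_ : has_inf
  [set h r | r in [set r | (exists k i, r = rational_time k i) /\ (t < r \/ r = T)]]).
  split; last exact: right_limit_lbound.
  by exists (h T), T => //; split; [exact: rational_timeT|right].
by exists k, i; rewrite -rE; split => //; case: tr => [//|->].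
Qed.

Lemma right_limit_homo s t : s <= t -> right_limit h s <= right_limit h t.
Proof.
move=> st; apply: lb_le_inf.
  by exists (h T), T => //; split; [exact: rational_timeT|right].
move=> _ [r [rD tr] <-]; apply: ge_inf; first exact: right_limit_lbound.
exists r => //; split => //; case: tr => [tr|->]; last by right.
by left; exact: le_lt_trans tr.
Qed.

(** Squeeze: the values at [right_time t k] are above the infimum, and below a nearly minimal value
    at a rational time [r > t] as soon as [right_time t k < r]. *)
Lemma right_limit_cvg t : 0 <= t <= T ->
  h (right_time t k) @[k --> \oo] --> right_limit h t.
Proof.
move=> t0T; have /andP[t0] := t0T; rewrite le_eqVlt => /predU1P[->|tT].
  by under eq_fun do rewrite right_timeT; rewrite right_limitT; exact: cvg_cst.
apply/cvgrPdist_lt => e e0; have [k0 [i0 [tr hr]]] := right_limit_adherent tT e0.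
near=> k.
have ge_lim : right_limit h t <= h (right_time t k).
  by apply: right_limit_le; apply: right_time_gt; rewrite t0.
have le_h : h (right_time t k) <= h (rational_time k0 i0).
  apply: hnd; apply: ltW; near: k.
  exact: (cvgr_lt _ (@right_time_cvg t t0T) _ tr).
by rewrite distrC ger0_norm ?subr_ge0// ltrBlDl (le_lt_trans le_h).
Unshelve. all: by end_near. Qed.

(** A rational time [r > t] of nearly minimal value also bounds the infimum at each [u] in []t,
    r[]. *)
Lemma right_limit_right_continuous t : t < T ->
  right_limit h u @[u --> t^'+] --> right_limit h t.
Proof.
move=> tT.
apply/cvgrPdist_lt => e e0; have [k0 [i0 [tr hr]]] := right_limit_adherent tT e0.
near=> u.
have ge_lim : right_limit h t <= right_limit h u.
  by apply: right_limit_homo; near: u; exact: nbhs_right_ge.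
have le_h : right_limit h u <= h (rational_time k0 i0).
  by apply: right_limit_le; near: u; exact: nbhs_right_lt.
by rewrite distrC ger0_norm ?subr_ge0// ltrBlDl (le_lt_trans le_h).
Unshelve. all: by end_near. Qed.

Lemma right_limit_left_limit t : cvg (right_limit h u @[u --> t^'-]).
Proof.
apply: nondecreasing_at_left_is_cvgr; apply: nearW => x.
  by move=> y z _ _; exact: right_limit_homo.
exists (right_limit h t) => _ [y yxt <-]; apply: right_limit_homo.
by move: yxt; rewrite /= in_itv/= => /andP[_ /ltW].
Qed.

End monotone.
End right_limits.

(** * Paths decreasing for a proper cone: integration and regularization *)

Section cone_decreasing_paths.
Context {R : realType} {n : nat} {T : R} {K : set 'rV[R]_n}.
Hypothesis hK : solvency_cone K.
Implicit Types (b : R -> 'rV[R]_n) (v : 'rV[R]_n).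

Lemma cvg_rV {I : Type} (F : set_system I) {FF : Filter F}
    (u : I -> 'rV[R]_n) (z : 'rV[R]_n) :
  (forall j, u i 0 j @[i --> F] --> z 0 j) -> u i @[i --> F] --> z.
Proof.
move=> uz; apply/cvgrPdist_lt => e e0.
have : \forall i \near F, forall j, `|z 0 j - u i 0 j| < e.
  apply: filter_forall => j.
  by have /cvgrPdist_lt/(_ e e0) := uz j.
by apply: filterS => i ui; apply: norm_rV_lt => // j; rewrite !mxE.
Qed.

Lemma cvg_coord {I : Type} (F : set_system I) {FF : Filter F}
    (u : I -> 'rV[R]_n) (z : 'rV[R]_n) j :
  u i @[i --> F] --> z -> u i 0 j @[i --> F] --> z 0 j.
Proof.
move=> uz; apply/cvgrPdist_lt => e e0; near=> i.
have : `|z - u i| < e by near: i; exact: cvgr_dist_lt.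
by apply: le_lt_trans; have := coord_le_norm (z - u i) j; rewrite !mxE.
Unshelve. all: by end_near. Qed.

Definition dominates v := forall z j, K z -> `|z 0 j| <= dot v z.

(** Jordan decomposition: [b t 0 j] is [- dot v (b t)] minus [major v b j t], and if [v] dominates
    the coordinates on [K], both terms are nondecreasing along a [K]-decreasing path. *)
Definition major v b (j : 'I_n) (t : R) := - dot v (b t) - b t 0 j.

Lemma decreasing_dot v b (j : 'I_n) s t : dominates v -> opp_cone K (b t - b s) ->
  - dot v (b s) <= - dot v (b t).
Proof.
move=> vK [z Kz zE]; have := le_trans (normr_ge0 _) (vK _ j Kz).
have : dot v (- z) = dot v (b t) - dot v (b s) by rewrite zE dotBr.
rewrite dotNr; lra.
Qed.

Lemma decreasing_major v b j s t : dominates v -> opp_cone K (b t - b s) ->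
  major v b j s <= major v b j t.
Proof.
move=> vK [z Kz zE]; have /(vK _ j) := Kz; rewrite ler_norml => /andP[z1 z2].
have zj : - z 0 j = b t 0 j - b s 0 j.
  by have := congr1 (fun w : 'rV_n => w 0 j) zE; rewrite !mxE.
have : dot v (- z) = dot v (b t) - dot v (b s) by rewrite zE dotBr.
rewrite dotNr /major; lra.
Qed.

(** [RS_integral] has its meaning only once an integral exists; it does, as the difference of the
    integrals against the two monotone parts of coordinate [j]. *)
Lemma strategy_RS_integral b f t j : decreasing_paths T K b -> 0 <= t <= T ->
  {within `[0, T], continuous f} ->
  uniform_sum f (fun s => b s 0 j) t k @[k --> \oo] -->
    RS_integral f (fun s => b s 0 j) 0 t.
Proof.
move=> [[brc _] bdec] /andP[t0 tT] cf.
have [v vK] := cone_positive_functional (solvency_closed hK)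
  (solvency_convex hK) (solvency_is_cone hK) (solvency_proper hK).
apply: is_RS_integral_cvg => //; rewrite /RS_integral; apply: xgetPex.
have cft : {within `[0, t], continuous f}.
  apply: continuous_subspaceW cf => u /=; rewrite !in_itv/= => /andP[-> ut].
  exact: le_trans tT.
have rc s : 0 <= s < t -> b u @[u --> s^'+] --> b s.
  by move=> /andP[s0 st]; apply: brc; rewrite s0 (lt_le_trans st).
have dec r s : 0 <= r -> r <= s -> s <= t -> opp_cone K (b s - b r).
  by move=> r0 rs st; apply: bdec => //; exact: le_trans tT.
have rcd s : 0 <= s < t -> - dot v (b u) @[u --> s^'+] --> - dot v (b s).
  by move=> /rc bs; apply: cvgN; apply: continuous_cvg => //; exact: dot_continuous.
have [I hI] := @is_RS_integral_nondecreasing R f (fun s => - dot v (b s)) 0 t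
  t0 cft (fun r s r0 rs st => decreasing_dot j vK (dec r s r0 rs st)) rcd.
have [I' hI'] := @is_RS_integral_nondecreasing R f (major v b j) 0 t
  t0 cft (fun r s r0 rs st => decreasing_major j vK (dec r s r0 rs st))
  (fun s st => cvgB (rcd s st) (cvg_coord (rc s st))).
exists (I - I'); apply: eq_is_RS_integral (is_RS_integralB hI hI') => s _.
by rewrite /major /=; ring.
Qed.

Definition regularize v b t : 'rV[R]_n :=
  \row_j (right_limit (T := T) (fun r => - dot v (b r)) t -
          right_limit (T := T) (major v b j) t).

Hypothesis T_gt0 : 0 < T.

Definition rationally_decreasing b :=
  forall k i k' i', rational_time (T := T) k i <= rational_time (T := T) k' i' ->
  opp_cone K (b (rational_time (T := T) k' i') - b (rational_time (T := T) k i)).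

Lemma regularize_cvg v b t : dominates v -> rationally_decreasing b ->
  0 <= t <= T ->
  b (right_time (T := T) t k) @[k --> \oo] --> regularize v b t.
Proof.
move=> vK bdec t0T; apply: cvg_rV => j; rewrite mxE.
rewrite (_ : (fun k => _) = (fun k => - dot v (b (right_time (T := T) t k)) -
    major v b j (right_time (T := T) t k))); last first.
  by apply/funext => k; rewrite /major; ring.
apply: cvgB; apply: right_limit_cvg => // k i k' i' /bdec.
  exact: decreasing_dot.
exact: decreasing_major.
Qed.

Lemma regularize_decreasing v b : dominates v -> rationally_decreasing b ->
  decreasing_paths T K (regularize v b).
Proof.
move=> vK bdec.
have dnd k i k' i' := fun j H => decreasing_dot j vK (bdec k i k' i' H).
have mnd k i k' i' := fun j H => decreasing_major j vK (bdec k i k' i' H).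
split; [split|] => [t tT|t tT|s t s0 st tT].
- apply: cvg_rV => j; rewrite mxE.
  rewrite (_ : (fun u => _) = (fun u =>
      right_limit (T := T) (fun r => - dot v (b r)) u -
      right_limit (T := T) (major v b j) u)); last first.
    by apply/funext => u; rewrite mxE.
  by case/andP: tT => _ tT; apply: cvgB;
    apply: right_limit_right_continuous => // k i k' i' H; [apply: dnd|apply: mnd].
- apply/cvg_ex; exists (\row_j lim (regularize v b u 0 j @[u --> t^'-])).
  apply: cvg_rV => j; rewrite mxE.
  suff : cvg (regularize v b u 0 j @[u --> t^'-]) by [].
  rewrite (_ : (fun u => _) = (fun u =>
      right_limit (T := T) (fun r => - dot v (b r)) u -
      right_limit (T := T) (major v b j) u)); last first.
    by apply/funext => u; rewrite mxE.
  by apply: is_cvgB; apply: right_limit_left_limit => // k i k' i' H;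
    [apply: dnd|apply: mnd].
(* For fixed [k], [right_time] is monotone in time, so the increments along the grids lie in [- K];
   closedness of [K] carries this to the limit. *)
- exists (regularize v b s - regularize v b t); last by rewrite opprB.
  have c1 : b (right_time (T := T) s k) @[k --> \oo] --> regularize v b s.
    by apply: regularize_cvg => //; rewrite s0 (le_trans st).
  have c2 : b (right_time (T := T) t k) @[k --> \oo] --> regularize v b t.
    by apply: regularize_cvg => //; rewrite tT (le_trans s0).
  refine (@closed_cvg _ _ _ _ _ K (solvency_closed hK) _ _ (cvgB c1 c2)).
  apply: nearW => k; have [z Kz zE] := bdec _ _ _ _ (right_time_homo T_gt0 k st).
  by apply: (eq_ind z K Kz); rewrite -[LHS]opprK zE opprB.
Qed.

End cone_decreasing_paths.

(** * Measurability of vector-valued maps *)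

Section countable_quantifiers.
Context {d : measure_display} {X : measurableType d} {I : countType}.
Implicit Types Q : I -> X -> Prop.

Lemma measurable_exists Q :
  (forall i, measurable [set x | Q i x]) -> measurable [set x | exists i, Q i x].
Proof.
move=> mQ; rewrite (_ : [set x | _] = \bigcup_i [set x | Q i x]).
  exact: countable_bigcupT_measurable.
by apply/seteqP; split => [x [i Qi]|x [i _ Qi]]; exists i.
Qed.

Lemma measurable_forall Q :
  (forall i, measurable [set x | Q i x]) -> measurable [set x | forall i, Q i x].
Proof.
move=> mQ; rewrite (_ : [set x | _] = ~` [set x | exists i, ~ Q i x]).
  by apply: measurableC; apply: measurable_exists => i; exact: (measurableC (mQ i)).
apply/seteqP; split => [x Qx [i]|x /= nQ i]; first exact.
by apply: contrapT => nQi; apply: nQ; exists i.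
Qed.

End countable_quantifiers.

Lemma measurable_const_and d (X : measurableType d) (b : Prop) (Q : set X) :
  measurable Q -> measurable [set x | b /\ Q x].
Proof.
move=> mQ; have [b1|b0] := pselect b.
  rewrite (_ : [set x | _] = Q)//; apply/seteqP.
  by split => [x [_ Qx]|x Qx]; [exact: Qx|split].
by rewrite (_ : [set x | _] = set0)//; apply/seteqP; split => [x []|x].
Qed.

Lemma measurable_const_imp d (X : measurableType d) (b : Prop) (Q : set X) :
  measurable Q -> measurable [set x | b -> Q x].
Proof.
move=> mQ; have [b1|b0] := pselect b.
  rewrite (_ : [set x | _] = Q)//; apply/seteqP.
  by split => [x Qx|x Qx _]; [exact: Qx|exact: Qx].
by rewrite (_ : [set x | _] = setT)//; apply/seteqP; split => [x _|x _ /b0].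
Qed.

Section borel_vectors.
Context {R : realType} {n : nat}.

Lemma measurable_open_rV (A : set 'rV[R]_n) : open A ->
  measurable (A : set (borel_rV R n)).
Proof. by move=> oA; exact: sub_sigma_algebra. Qed.

Lemma measurable_closed_rV (A : set 'rV[R]_n) : closed A ->
  measurable (A : set (borel_rV R n)).
Proof.
move=> cA; rewrite -[A]setCK; apply: measurableC; apply: measurable_open_rV.
exact: closed_openC.
Qed.

Lemma measurable_coord_rV (j : 'I_n) :
  measurable_fun setT (fun z : borel_rV R n => z 0 j).
Proof.
apply: (measurability _ (RGenOpens.measurableE R)) => _ [_ [a [b ->]] <-].
rewrite setTI; apply: measurable_open_rV.
by apply: open_comp => [z _|]; [exact: coord_continuous|exact: interval_open].
Qed.

(** Open sets generate the Borel sets, and each is a countable union of boxes with rational centre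
    and radius, whose preimages are expressed by coordinates. *)
Lemma measurable_fun_rV d (X : measurableType d) (f : X -> borel_rV R n) :
  (forall j, measurable_fun setT (fun x => f x 0 j)) -> measurable_fun setT f.
Proof.
move=> mf.
pose box (q : 'rV[rat]_n * rat) : set 'rV[R]_n :=
  [set z | forall j, `|z 0 j - ratr (q.1 0 j)| < ratr q.2].
have mbox q : measurable (f @^-1` box q).
  apply: measurable_forall => j.
  rewrite (_ : [set x | _] =
      (fun x => f x 0 j) @^-1` ball (ratr (q.1 0 j) : R) (ratr q.2)).
    by rewrite -[X in measurable X]setTI; apply: mf => //; exact: measurable_ball.
  by apply/seteqP; split => x; rewrite /ball/= distrC.
apply: (@measurability _ _ X (borel_rV R n) setT f (@open 'rV[R]_n) erefl).
move=> _ [A oA <-]; rewrite setTI.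
rewrite (_ : f @^-1` A = [set x | exists q, box q `<=` A /\ box q (f x)]).
  by apply: measurable_exists => q; apply: measurable_const_and; exact: mbox.
apply/seteqP; split => [x Afx|x [q [qA qx]]]; last exact: qA.
have /nbhs_ballP[e /= e0 fxA] : nbhs (f x : 'rV[R]_n) A by exact: open_nbhs_nbhs.
have e20 : 0 < e / 2 by rewrite divr_gt0.
have [r] := rat_in_itvoo e20; rewrite in_itv/= => /andP[r0 re].
have close j : exists c : rat, `|f x 0 j - ratr c| < ratr r :> R.
  have fr : f x 0 j - ratr r < f x 0 j + ratr r by lra.
  have [c] := rat_in_itvoo fr; rewrite in_itv/= => /andP[c1 c2]; exists c.
  by rewrite ltr_norml; apply/andP; split; lra.
exists (\row_j projT1 (cid (close j)), r); split => [z zbox|j /=]; last first.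
  by rewrite mxE; case: cid.
apply: fxA; rewrite -ball_normE /=; apply: norm_rV_lt => // j; rewrite !mxE.
have := zbox j; rewrite /= mxE; case: cid => c /= fc zc.
rewrite -(subrKA (ratr c)) (le_lt_trans (ler_normD _ _))// [X in _ + X]distrC; lra.
Qed.

End borel_vectors.

(** * Measurable functions defined everywhere from limits and rational cuts *)

Section measurable_choice.
Context {R : realType} {d : measure_display} {X : measurableType d}.

(** The upper limit is measurable and equals the limit wherever there is one; this allows sequences
    that converge only for some paths. *)
Lemma measurable_limit (f : nat -> X -> R) : (forall k, measurable_fun setT (f k)) ->
  exists2 g : X -> R, measurable_fun setT g &
    forall x l, f k x @[k --> \oo] --> l -> g x = l.
Proof.
move=> mf; exists (fun x => fine (limn_esup (fun k => (f k x)%:E))).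
  apply: (@measurableT_comp _ _ _ _ _ _ (@fine R)) => //.
  by apply: measurable_fun_limn_esup => k; apply/measurable_EFinP.
move=> x l fl.
have : (f k x)%:E @[k --> \oo] --> l%:E by apply: cvg_EFin => //; exact: nearW.
by move=> /cvg_limn_einf_sup[_ ->].
Qed.

(** [g] is the infimum of the rationals whose set contains [x]. The conclusion is pointwise because
    the sets [A q] will come from events known up to null sets, so they form a cut only at almost
    every point. *)
Lemma measurable_of_rational_cuts (A : rat -> set X) : (forall q, measurable (A q)) ->
  exists2 g : X -> R, measurable_fun setT g &
    forall x r, (forall q, A q x <-> r < ratr q) -> g x = r.
Proof.
move=> mA.
pose g x := ereal_inf [set (ratr q : R)%:E | q in [set q | A q x]].
have mg : measurable_fun setT g.
  apply: (measurability _ (ErealGenInftyO.measurableE R)) => _ [_ [y ->] <-].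
  rewrite setTI (_ : _ @^-1` _ = [set x | exists q, (ratr q : R) < y /\ A q x]).
    by apply: measurable_exists => q; exact: measurable_const_and.
  apply/seteqP; split => x; rewrite /= in_itv/=.
    by move=> /ereal_inf_lt[_ [q Aq <-]]; rewrite lte_fin => qy; exists q.
  move=> [q [qy Aq]]; apply: le_lt_trans (_ : (ratr q : R)%:E < _)%E; last first.
    by rewrite lte_fin.
  by apply: ereal_inf_lbound; exists q.
exists (fun x => fine (g x)); first exact: measurableT_comp.
move=> x r Ar; suff -> : g x = r%:E by [].
apply/eqP; rewrite eq_le; apply/andP; split.
  apply/lee_addgt0Pr => e e0.
  have re : r < r + e by rewrite ltrDl.
  have [q] := rat_in_itvoo re; rewrite in_itv/= => /andP[rq qe].
  apply: (@le_trans _ _ (ratr q : R)%:E).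
    by apply: ereal_inf_lbound; exists q => //; exact/Ar.
  by rewrite -EFinD lee_fin ltW.
by apply: le_ereal_inf_tmp => _ [q /= /Ar rq <-]; rewrite lee_fin ltW.
Qed.

End measurable_choice.

(** * Strategies as functionals of the path *)

Lemma ae_forall d (X : measurableType d) (R : realType)
    (mu : {measure set X -> \bar R}) (I : countType) (Q : I -> X -> Prop) :
  (forall i, {ae mu, forall x, Q i x}) -> {ae mu, forall x, forall i, Q i x}.
Proof.
move=> aeQ.
have : {ae mu, forall x, forall k : nat, forall i, unpickle k = Some i -> Q i x}.
  apply: ae_foralln => k; case: (unpickle k) => [i|]; last exact: nearW.
  by apply: filterS (aeQ i) => x Qx _ [<-].
by apply: filterS => x Qx i; apply: (Qx (pickle i)); rewrite pickleK.
Qed.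

Section past.
Context {R : realType} {p d : nat} {T : R}.

(** Only the first component of the pair enters, as the filtration of a model comes from [Y] alone,
    up to null sets. *)
Definition past_cylinders (t : R) :
    set (set ((R -> 'rV[R]_p) * (R -> 'rV[R]_d))) :=
  [set E | exists s (A : set (borel_rV R p)),
     [/\ 0 <= s <= t, measurable A & E = [set f | A (f.1 s)]]].

Definition past_space (t : R) := g_sigma_algebraType (past_cylinders t).

Lemma past_measurable t (A : set (past_space t)) : t <= T ->
  measurable A -> measurable (A : set (@path_space R p d T)).
Proof.
move=> tT; apply: sub_sigma_algebra2 => _ [s [A' [/andP[s0 st] mA' ->]]].
by left; exists s, A'; split => //; rewrite s0 (le_trans st).
Qed.

Lemma path_snd_measurable t : 0 <= t <= T ->
  measurable_fun setT (fun f : @path_space R p d T => f.2 t : borel_rV R d).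
Proof.
move=> tT _ A mA; rewrite setTI; apply: sub_sigma_algebra; right.
by exists t, A.
Qed.

Variable M : market_model p d T.
Notation P := (mm_prob M).
Notation J := (@joint_path R p d T M).

Lemma filtration_measurable t E : 0 <= t <= T ->
  mm_filtration M t E -> measurable E.
Proof.
move=> tT; rewrite mm_filtrationE//; apply: smallest_sub E.
  exact: sigma_algebra_measurable.
move=> F [[s [A [/andP[s0 st] mA ->]]]|[]//].
rewrite -[_ @^-1` _]setTI; apply: mm_Y_measurable => //.
by rewrite s0 (le_trans st)//; case/andP: tT.
Qed.

Lemma filtration_sigma_algebra t : 0 <= t <= T ->
  sigma_algebra setT (mm_filtration M t).
Proof. by move=> tT; rewrite mm_filtrationE//; exact: smallest_sigma_algebra. Qed.

Lemma filtration_null t N : 0 <= t <= T -> measurable N -> P N = 0%E ->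
  mm_filtration M t N.
Proof.
by move=> tT mN PN; rewrite mm_filtrationE//; apply: sub_sigma_algebra; right.
Qed.

Lemma adapted_measurable m (X : R -> mm_space M -> 'rV[R]_m) t : 0 <= t <= T ->
  adapted T (mm_filtration M) X ->
  measurable_fun setT (X t : mm_space M -> borel_rV R m).
Proof.
move=> tT aX _ A mA; rewrite setTI.
exact: filtration_measurable (aX t tT A mA).
Qed.

Lemma joint_path_measurable : measurable_fun setT J.
Proof.
apply: (@measurability _ _ _ (@path_space R p d T) setT _ (@cylinders R p d T) erefl).
move=> _ [_ [[t [A [tT mA ->]]]|[t [A [tT mA ->]]]] <-].
  exact: mm_Y_measurable.
by apply: adapted_measurable => //; exact: mm_S_adapted.
Qed.

Lemma past_preimage t (A : set (past_space t)) : 0 <= t <= T ->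
  measurable A -> mm_filtration M t (J @^-1` A).
Proof.
move=> tT; apply: (smallest_sub (X := [set A | mm_filtration M t (J @^-1` A)])).
  have [F0 FC FU] := filtration_sigma_algebra tT.
  split => [|B /FC|F FF] /=; first by rewrite preimage_set0.
    by rewrite !setTD preimage_setC.
  by rewrite preimage_bigcup; exact: FU.
move=> _ [s [B [st mB ->]]] /=; rewrite mm_filtrationE//.
by apply: sub_sigma_algebra; left; exists s, B.
Qed.

(** The sets that agree almost surely with a past event of the path form a sigma-algebra. It
    contains the events of [Y] up to [t], and the null sets, which agree with the empty event. *)
Lemma filtration_past t E : 0 <= t <= T -> mm_filtration M t E ->
  exists2 A : set (past_space t), measurable A &
    {ae P, forall w, E w <-> A (J w)}.
Proof.
move=> tT; rewrite mm_filtrationE//.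
apply: (smallest_sub (X := [set E | exists2 A : set (past_space t), measurable A &
    {ae P, forall w, E w <-> A (J w)}])).
  split => [|B [A mA BA]|F FA] /=.
  - by exists set0 => //; exact: nearW.
  - exists (~` A); first exact: measurableC.
    apply: filterS BA => w BAw; split => [[_ nB] Aw|nA].
      by apply: nB; exact/BAw.
    by split => // Bw; apply: nA; exact/BAw.
  - pose A n := projT1 (cid2 (FA n)).
    exists (\bigcup_n A n).
      by apply: bigcupT_measurable => n; rewrite /A; case: cid2.
    have : {ae P, forall w, forall n, F n w <-> A n (J w)}.
      by apply: ae_foralln => n; rewrite /A; case: cid2.
    by apply: filterS => w FAw; split => -[n _ /FAw ?]; exists n.
move=> N [[s [A [st mA ->]]]|[mN N0]] /=.
  exists [set f | A (f.1 s)]; last exact: nearW.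
  by apply: sub_sigma_algebra; exists s, A.
exists set0 => //; exists N; split => // w /=.
by apply: contra_notP => Nw; split.
Qed.

(** Outside a null set [N], [E'] is [E]; inside, it is itself null. Both pieces are in the
    filtration, which contains the null sets. *)
Lemma filtration_ae_eq t E E' : 0 <= t <= T -> mm_filtration M t E ->
  measurable E' -> {ae P, forall w, E w <-> E' w} -> mm_filtration M t E'.
Proof.
move=> tT FE mE' [N [mN N0 EE'N]].
have NE w : ~ N w -> E w <-> E' w by apply: contra_notP => /EE'N.
have -> : E' = (E `\` N) `|` (E' `&` N).
  apply/seteqP; split => [w E'w|w [[Ew /NE]|[]]]; last by [].
    by have [Nw|nNw] := pselect (N w); [right|left; split => //; apply/NE].
  by move=> EE'; exact/EE'.
have FN : mm_filtration M t N by exact: filtration_null.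
have FE'N : mm_filtration M t (E' `&` N).
  apply: filtration_null => //; first exact: measurableI.
  by apply: subset_measure0 N0 => //; exact: measurableI.
move: FE FN FE'N; rewrite mm_filtrationE// => FE FN FE'N.
pose X := g_sigma_algebraType ([set E | exists s (A : set (borel_rV R p)),
   [/\ 0 <= s <= t, measurable A & E = mm_Y M s @^-1` A]]
      `|` [set N | measurable N /\ P N = 0%E]).
exact: (@measurableU _ X _ _ (@measurableD _ X _ _ FE FN) FE'N).
Qed.

(** Doob-Dynkin factorization up to a null set: each coordinate of [X] is determined by its rational
    sublevel events, which are replaced by past events of the path at the cost of countably many
    null sets. *)
Lemma filtration_factor m t (X : mm_space M -> 'rV[R]_m) : 0 <= t <= T ->
  (forall A : set (borel_rV R m), measurable A ->
    mm_filtration M t (X @^-1` A)) ->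
  exists2 G : past_space t -> borel_rV R m, measurable_fun setT G &
    {ae P, forall w, G (J w) = X w}.
Proof.
move=> tT mX.
have FX j (q : rat) : mm_filtration M t [set w | X w 0 j < ratr q].
  apply: (mX [set z : borel_rV R m | z 0 j < ratr q]).
  rewrite (_ : [set z : borel_rV R m | _] =
      (fun z : borel_rV R m => z 0 j) @^-1` [set` `]-oo, ratr q[]).
    by rewrite -[X in measurable X]setTI; apply: measurable_coord_rV.
  by rewrite set_itvE.
pose A j q := projT1 (cid2 (filtration_past tT (FX j q))).
have mA j q : measurable (A j q) by rewrite /A; case: cid2.
have XA : {ae P, forall w, forall j q, X w 0 j < ratr q <-> A j q (J w)}.
  apply: ae_forall => j; apply: ae_forall => q.
  by rewrite /A; case: cid2.
have cut j := cid2 (@measurable_of_rational_cuts R _ (past_space t) (A j) (mA j)).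
pose G (f : past_space t) : borel_rV R m := \row_j projT1 (cut j) f.
exists G.
  apply: measurable_fun_rV => j; rewrite /G.
  rewrite (_ : (fun f => _) = projT1 (cut j)); first by case: (cut j).
  by apply/funext => f; rewrite mxE.
apply: filterS XA => w XA; apply/rowP => j; rewrite mxE; case: (cut j) => g _ /= gA.
by apply: gA => q; rewrite XA.
Qed.

End past.

Section law_transfer.
Context {R : realType} {p d : nat} {T : R} {M M' : market_model p d T}.
Hypothesis hlaw : same_law M M'.

Lemma same_law_ae (Q : set (@path_space R p d T)) : measurable Q ->
  {ae mm_prob M, forall w, Q (joint_path w)} ->
  {ae mm_prob M', forall w, Q (joint_path w)}.
Proof.
move=> mQ QJ; have mJ N : measurable (@joint_path R p d T N @^-1` ~` Q).
  rewrite -[X in measurable X]setTI; apply: joint_path_measurable => //.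
  exact: measurableC.
exists (@joint_path R p d T M' @^-1` ~` Q); split => //.
have := hlaw (measurableC mQ); rewrite /joint_law /pushforward => <-.
exact: measure_negligible.
Qed.

End law_transfer.

Section path_functional.
Context {R : realType} {p d : nat} {T : R}.
Hypothesis T_gt0 : 0 < T.
Variables (K : set 'rV[R]_d) (M : market_model p d T).
Hypothesis hK : solvency_cone K.
Notation P := (mm_prob M).
Notation J := (@joint_path R p d T M).

Lemma solvency_cone0 : K 0.
Proof.
by have : [set 0] (0 : 'rV[R]_d) by []; rewrite -(solvency_proper hK) => -[].
Qed.

Lemma decreasing_paths0 : decreasing_paths T K (fun=> 0).
Proof.
split; [split|] => [t _|t _|s t _ _ _]; first exact: cvg_cst.
  exact: is_cvg_cst.
by exists 0; [exact: solvency_cone0|rewrite oppr0 addr0].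
Qed.

Lemma closed_opp_cone : closed (opp_cone K).
Proof.
rewrite (_ : opp_cone K = -%R @^-1` K).
  apply: preimage_closed; last exact: solvency_closed.
  by move=> z _; exact: oppr_continuous.
apply/seteqP; split => [_ [z Kz <-]|z Kz] /=; first by rewrite opprK.
by exists (- z); rewrite ?opprK.
Qed.

Lemma rcll_right_time_cvg (b : R -> 'rV[R]_d) t : rcll T b -> 0 <= t <= T ->
  b (right_time (T := T) t k) @[k --> \oo] --> b t.
Proof.
move=> [brc _] tT; have /andP[t0] := tT; rewrite le_eqVlt => /predU1P[->|tltT].
  by under eq_fun do rewrite right_timeT//; exact: cvg_cst.
have t0T : 0 <= t < T by rewrite t0.
apply: cvg_comp (brc t t0T) => A At.
have : \forall k \near \oo, (fun u => t < u -> A u) (right_time (T := T) t k).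
  exact: (right_time_cvg T_gt0 tT) At.
by apply: filterS => k; apply; exact: right_time_gt.
Qed.

(** [beta f] is a [K]-decreasing path for every [f], so it can be evaluated in any model. Its value
    at [t] is a limit from times after [t]; the third clause, almost sure agreement with a
    functional of the past, is what gives adaptedness. *)
Lemma strategy_functional (B : R -> mm_space M -> 'rV[R]_d) : strategy K B ->
  exists beta : @path_space R p d T -> R -> 'rV[R]_d,
  [/\ forall f, decreasing_paths T K (beta f),
      forall t, 0 <= t <= T ->
        measurable_fun setT (fun f => beta f t : borel_rV R d),
      forall t, 0 <= t <= T -> exists2 G : past_space t -> borel_rV R d,
        measurable_fun setT G & {ae P, forall w, beta (J w) t = G (J w)} &
      {ae P, forall w, forall t, 0 <= t <= T -> beta (J w) t = B t w}].
Proof.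
move=> [aB pB].
have hG t : exists G : past_space t -> borel_rV R d, 0 <= t <= T ->
    measurable_fun setT G /\ {ae P, forall w, G (J w) = B t w}.
  have [tT|tT] := boolP (0 <= t <= T); last by exists (fun=> 0).
  by have [G mG GB] := filtration_factor tT (aB t tT); exists G.
pose G t : @path_space R p d T -> 'rV[R]_d := projT1 (cid (hG t)).
have mG t : 0 <= t <= T -> measurable_fun setT (G t : past_space t -> borel_rV R d).
  by rewrite /G; case: cid => g /= gP /gP[].
have GB t : 0 <= t <= T -> {ae P, forall w, G t (J w) = B t w}.
  by rewrite /G; case: cid => g /= gP /gP[].
have mpG t : 0 <= t <= T ->
    measurable_fun setT (G t : @path_space R p d T -> borel_rV R d).
  move=> tT _ A mA; apply: (@past_measurable _ _ _ _ t); first by case/andP: tT.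
  exact: mG.
have [v vK] := cone_positive_functional (solvency_closed hK)
  (solvency_convex hK) (solvency_is_cone hK) (solvency_proper hK).
(* Being decreasing along the rational times is a countable condition, hence a measurable one, and
   almost every path of [M] satisfies it. *)
pose E := [set f | @rationally_decreasing R d T K (fun r => G r f)].
have mE : measurable (E : set (@path_space R p d T)).
  apply: measurable_forall => k; apply: measurable_forall => i.
  apply: measurable_forall => k'; apply: measurable_forall => i'.
  apply: measurable_const_imp; set r := rational_time k i; set s := rational_time k' i'.
  have mGsr : measurable_fun setT
      ((fun f => G s f - G r f) : @path_space R p d T -> borel_rV R d).
    apply: measurable_fun_rV => j.
    rewrite (_ : (fun f => _) = (fun f => G s f 0 j - G r f 0 j)); last first.
      by apply/funext => f; rewrite !mxE.
    by apply: measurable_funB; apply: (measurableT_comp (measurable_coord_rV j));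
      apply: mpG; exact: rational_time_itv.
  have := mGsr measurableT _ (measurable_closed_rV closed_opp_cone).
  by rewrite setTI.
(* Off [E] the zero path is taken, which is [K]-decreasing because [K] contains 0. *)
pose beta f t : 'rV[R]_d :=
  if f \in E then regularize (T := T) v (fun r => G r f) t else 0.
have betaE f : E f -> beta f = regularize (T := T) v (fun r => G r f).
  by move=> Ef; apply/funext => t; rewrite /beta mem_set.
have beta0 f : ~ E f -> beta f = (fun=> 0).
  by move=> Ef; apply/funext => t; rewrite /beta memNset.
have betaB : {ae P, forall w, forall t, 0 <= t <= T -> beta (J w) t = B t w}.
  (* One null set serves all rational times; off it, [beta] and the right-continuous path of [B] are
     at every [t] limits of the same sequence. *)
  have GBr k i : {ae P, forall w,
      G (rational_time (T := T) k i) (J w) = B (rational_time (T := T) k i) w}.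
    by apply: GB; exact: rational_time_itv.
  have := ae_forall (fun k => ae_forall (GBr k)).
  apply: filterS => w GBw t tT.
  have EJ : E (J w).
    move=> k i k' i' le_time; rewrite !GBw; apply: (pB w).2 => //.
      by case/andP: (rational_time_itv T_gt0 k i).
    by case/andP: (rational_time_itv T_gt0 k' i').
  rewrite betaE//; have := rcll_right_time_cvg (pB w).1 tT.
  rewrite (_ : (fun k => _) = (fun k => G (right_time (T := T) t k) (J w))); last first.
    by apply/funext => k; rewrite GBw.
  move=> Bt; apply: (@cvg_unique _ (@norm_hausdorff _ _) _ _ _ _ _ Bt).
  exact: (regularize_cvg T_gt0 vK EJ tT).
exists beta; split => // [f|t tT|t tT].
- have [Ef|nEf] := pselect (E f); last by rewrite beta0//; exact: decreasing_paths0.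
  by rewrite betaE//; exact: regularize_decreasing.
- apply: measurable_fun_rV => j.
  (* The indicator of [E] makes the approximants converge off [E] too, to the value 0 of [beta]. *)
  apply: (@measurable_fun_cvg _ _ _ setT
    (fun k f => \1_E f * G (right_time (T := T) t k) f 0 j)) => [k|f _].
    apply: measurable_funM; first exact: measurable_indic.
    apply: (measurableT_comp (measurable_coord_rV j)).
    by apply: mpG; exact: right_time_itv.
  have [Ef|nEf] := pselect (E f).
    rewrite betaE//; under eq_fun do rewrite indicE mem_set// mul1r.
    apply: cvg_coord; exact: (regularize_cvg T_gt0 vK Ef tT).
  rewrite beta0// mxE; under eq_fun do rewrite indicE memNset// mul0r.
  exact: cvg_cst.
- exists (G t); first exact: mG.
  by apply: filterS2 betaB (GB t tT) => w -> // ->.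
Qed.

End path_functional.

(** * Transfer of strategies between models *)

(** Inversion is continuous off 0, and since the inverse of 0 is 0 by convention, it is the
    extension by 0 of that restriction. *)
Lemma measurable_inv {R : realType} : measurable_fun setT (@GRing.inv R).
Proof.
have mD := measurableC (measurable_set1 (0 : R)).
rewrite (_ : @GRing.inv R = (@GRing.inv R) \_ (~` [set 0])).
  apply/(measurable_restrictT _ mD).
  apply: open_continuous_measurable_fun; first exact: closed_openC.
  by move=> y /set_mem /= y0; apply: inv_continuous; exact/eqP.
apply/funext => y; rewrite /patch; case: ifPn => // /negP.
by move=> y0; have [->|/eqP yn0] := eqVneq y 0; [rewrite invr0|case: y0; rewrite inE].
Qed.

(** * Wealth as a measurable functional of the path *)

Section wealth_functional.
Context {R : realType} {p d : nat} {T : R}.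
Hypothesis T_gt0 : 0 < T.
Variables (K : set 'rV[R]_d) (x : 'rV[R]_d).
Hypothesis hK : solvency_cone K.

(** The wealth with uniform sums in place of the integrals: it evaluates the paths at finitely many
    times. *)
Definition wealth_sum (s b : R -> 'rV[R]_d) (t : R) (k : nat) : 'rV[R]_d :=
  \row_j (s t 0 j * (x 0 j + ((s 0 0 j)^-1 * b 0 0 j +
    uniform_sum (fun u => (s u 0 j)^-1) (fun u => b u 0 j) t k))).

Lemma eq_wealth_sum s b b' t k : 0 <= t <= T ->
  (forall u, 0 <= u <= T -> b u = b' u) ->
  wealth_sum s b t k = wealth_sum s b' t k.
Proof.
move=> /andP[t0 tT] bb'; apply/rowP => j; rewrite !mxE bb' ?lexx ?ltW//.
congr (_ * (_ + (_ + _))); apply: eq_bigr => i _.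
have gT m : (m <= k.+1)%N -> 0 <= grid t k m <= T.
  by move=> mk; have /andP[-> gt] := grid_itv t0 mk; exact: le_trans tT.
by rewrite !bb'// gT// ltnW.
Qed.

Lemma wealth_sum_cvg (N : market_model p d T) (B : R -> mm_space N -> 'rV[R]_d) t w :
  decreasing_paths T K (B ^~ w) -> 0 <= t <= T ->
  wealth_sum (mm_S N ^~ w) (B ^~ w) t k @[k --> \oo] --> wealth x B t w.
Proof.
move=> pB tT; apply: cvg_rV => j; rewrite !mxE.
rewrite (_ : (fun k => _) = (fun k => mm_S N t w 0 j * (x 0 j +
  ((mm_S N 0 w 0 j)^-1 * B 0 w 0 j +
  uniform_sum (fun u => (mm_S N u w 0 j)^-1) (fun u => B u w 0 j) t k)))); last first.
  by apply/funext => k; rewrite mxE.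
apply: cvgM; first exact: cvg_cst.
apply: cvgD; first exact: cvg_cst.
apply: cvgD; first exact: cvg_cst.
have cS : {within `[0, T], continuous (fun u => (mm_S N u w 0 j)^-1)}.
  rewrite continuous_subspace_in => u; rewrite inE/= in_itv/= => uT.
  apply: cvgV; first by rewrite gt_eqF//; exact: mm_S_pos.
  by have := @mm_S_continuous R p d T N w u; exact: cvg_coord.
exact: (@strategy_RS_integral _ _ _ _ hK _ _ _ j pB tT cS).
Qed.

Lemma measurable_wealth_sum e (X : measurableType e) (s b : R -> X -> 'rV[R]_d) t k :
  0 <= t <= T ->
  (forall u, 0 <= u <= T -> measurable_fun setT (s u : X -> borel_rV R d)) ->
  (forall u, 0 <= u <= T -> measurable_fun setT (b u : X -> borel_rV R d)) ->
  measurable_fun setT ((fun w => wealth_sum (s ^~ w) (b ^~ w) t k) : X -> borel_rV R d).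
Proof.
move=> tT ms mb; apply: measurable_fun_rV => j.
rewrite (_ : (fun w => _) = (fun w => s t w 0 j * (x 0 j +
  ((s 0 w 0 j)^-1 * b 0 w 0 j +
  uniform_sum (fun u => (s u w 0 j)^-1) (fun u => b u w 0 j) t k)))); last first.
  by apply/funext => w; rewrite mxE.
have mc (y : R -> X -> 'rV[R]_d) u :
    measurable_fun setT (y u : X -> borel_rV R d) ->
    measurable_fun setT (fun w => y u w 0 j).
  by move=> my; exact: (measurableT_comp (measurable_coord_rV j)).
have minv u : 0 <= u <= T -> measurable_fun setT (fun w => (s u w 0 j)^-1).
  by move=> uT; apply: (measurableT_comp measurable_inv); apply: mc; exact: ms.
have T0 : (0 : R) <= 0 <= T by rewrite lexx/= ltW.
apply: measurable_funM; first by apply: mc; exact: ms.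
apply: measurable_funD => //; apply: measurable_funD.
  by apply: measurable_funM; [exact: minv|apply: mc; exact: mb].
apply: measurable_sum => i.
have gT m : (m <= k.+1)%N -> 0 <= grid t k m <= T.
  case/andP: tT => t0 tT mk.
  by have /andP[-> gt] := grid_itv t0 mk; exact: le_trans tT.
apply: measurable_funM; first by apply/minv/gT/ltnW.
by apply: measurable_funB; apply: mc; apply: mb; apply: gT; rewrite // ltnW.
Qed.

(** [Psi] is a limit of wealth sums built from the path of [S] and from [beta], so one functional
    serves every model and every strategy that follows [beta]. *)
Lemma wealth_functional (beta : @path_space R p d T -> R -> 'rV[R]_d) t :
  (forall u, 0 <= u <= T -> measurable_fun setT (fun f => beta f u : borel_rV R d)) ->
  0 <= t <= T ->
  exists2 Psi : @path_space R p d T -> borel_rV R d, measurable_fun setT Psi &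
  forall (N : market_model p d T) (B : R -> mm_space N -> 'rV[R]_d) w,
    decreasing_paths T K (B ^~ w) ->
    (forall u, 0 <= u <= T -> beta (joint_path w) u = B u w) ->
    Psi (joint_path w) = wealth x B t w.
Proof.
move=> mbeta tT.
pose W k (f : @path_space R p d T) : borel_rV R d := wealth_sum f.2 (beta f) t k.
have mW k j : measurable_fun setT (fun f => W k f 0 j).
  apply: (measurableT_comp (measurable_coord_rV j)).
  apply: (@measurable_wealth_sum _ (@path_space R p d T)
    (fun u f => f.2 u) (fun u f => beta f u) t k tT) => // u uT.
  exact: path_snd_measurable.
pose lim_W j := cid2 (measurable_limit (fun k => mW k j)).
exists (fun f => \row_j projT1 (lim_W j) f).
  apply: measurable_fun_rV => j.
  rewrite (_ : (fun f => _) = projT1 (lim_W j)); first by case: (lim_W j).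
  by apply/funext => f; rewrite mxE.
move=> N B w pB betaB; apply/rowP => j; rewrite mxE.
case: (lim_W j) => g _ /= gW; apply: gW; apply: cvg_coord.
rewrite (_ : (fun k => _) = wealth_sum (mm_S N ^~ w) (B ^~ w) t).
  exact: wealth_sum_cvg.
by apply/funext => k; exact: eq_wealth_sum.
Qed.

(** A given strategy follows a functional of the path only almost surely, so the measurability of
    its wealth is proved directly, again by wealth sums. *)
Lemma measurable_wealth (N : market_model p d T) (B : R -> mm_space N -> 'rV[R]_d) t :
  strategy K B -> 0 <= t <= T ->
  measurable_fun setT (wealth x B t : mm_space N -> borel_rV R d).
Proof.
move=> [aB pB] tT; apply: measurable_fun_rV => j.
apply: (@measurable_fun_cvg _ _ _ setT
  (fun k w => wealth_sum (mm_S N ^~ w) (B ^~ w) t k 0 j)) => [k|w _].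
  apply: (measurableT_comp (measurable_coord_rV j)).
  apply: measurable_wealth_sum => // u uT; apply: adapted_measurable => //.
  exact: mm_S_adapted.
by apply: cvg_coord; exact: wealth_sum_cvg.
Qed.

End wealth_functional.

Section transfer.
Context {R : realType} {p d : nat} {T : R}.
Hypothesis T_gt0 : 0 < T.
Variables (K : set 'rV[R]_d) (U : 'rV[R]_d -> \bar R) (x : 'rV[R]_d).
Hypotheses (hK : solvency_cone K) (hU : utility K U).

(** For nonnegative integrands this is a change of variables to the common law; positive and
    negative parts give the general case. *)
Lemma integral_same_law (M M' : market_model p d T) (h : borel_rV R d -> \bar R)
    (Psi : @path_space R p d T -> borel_rV R d) : same_law M M' ->
  measurable_fun setT h -> measurable_fun setT Psi ->
  (\int[mm_prob M]_w h (Psi (joint_path w)) =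
   \int[mm_prob M']_w h (Psi (joint_path w)))%E.
Proof.
move=> hlaw mh mPsi.
have mJ N : measurable_fun setT (@joint_path R p d T N) :=
  @joint_path_measurable R p d T N.
have ge0_case (g : borel_rV R d -> \bar R) : measurable_fun setT g ->
    (forall z, 0 <= g z)%E ->
    (\int[mm_prob M]_w g (Psi (joint_path w)) =
     \int[mm_prob M']_w g (Psi (joint_path w)))%E.
  move=> mg g0.
  have push N : (\int[mm_prob N]_w g (Psi (@joint_path R p d T N w)) =
      \int[pushforward (mm_prob N) (@joint_path R p d T N)]_f g (Psi f))%E.
    rewrite (@ge0_integral_pushforward _ _ _ _ _ _ (mJ N) _ setT (g \o Psi))//.
      exact: measurableT_comp.
    by move=> f _; exact: g0.
  rewrite !push; apply: eq_measure_integral => A mA _; exact: hlaw.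
rewrite integralE [RHS]integralE; congr (_ - _)%E.
  rewrite !(funepos_comp h (Psi \o _)).
  exact: (ge0_case (h^\+)%E (measurable_funepos mh) (funepos_ge0 h)).
rewrite !(funeneg_comp h (Psi \o _)).
exact: (ge0_case (h^\-)%E (measurable_funeneg mh) (funeneg_ge0 h)).
Qed.

(** [B'] is [beta] along the paths of [M']. Adaptedness, admissibility and expected utility each
    reduce to a statement about the law of [(Y, S)]. *)
Lemma transfer_strategy (M M' : market_model p d T)
    (B : R -> mm_space M -> 'rV[R]_d) : same_law M M' -> admissible K x B ->
  exists2 B' : R -> mm_space M' -> 'rV[R]_d, admissible K x B' &
    expected_utility K U x B' = expected_utility K U x B.
Proof.
move=> hlaw [sB BK].
have [beta [pbeta mbeta beta_past betaB]] := strategy_functional T_gt0 hK sB.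
pose B' t (w : mm_space M') : 'rV[R]_d := beta (joint_path w) t.
have sB' : strategy K B'.
  split => [t tT A mA|w]; last exact: pbeta.
  have [G mG betaG] := beta_past t tT.
  have mpG : measurable_fun setT (G : @path_space R p d T -> borel_rV R d).
    by move=> _ C mC; apply: (@past_measurable _ _ _ _ t); [case/andP: tT|exact: mG].
  (* As a measurable event on paths, the equality of [beta] at [t] with [G] passes from [M] to [M'];
     the null sets in the filtration absorb the exception. *)
  have mE : measurable [set f : @path_space R p d T | beta f t = G f].
    rewrite (_ : [set f | _] = [set f | forall j, beta f t 0 j = G f 0 j]).
      apply: measurable_forall => j.
      rewrite (_ : [set f | _] = (fun f => beta f t 0 j - G f 0 j) @^-1` [set 0]).
        rewrite -[X in measurable X]setTI; apply: measurable_funB => //.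
          by apply: (measurableT_comp (measurable_coord_rV j)); exact: mbeta.
        exact: (measurableT_comp (measurable_coord_rV j)).
      apply/seteqP; split => f /= H; first by rewrite H subrr.
      by apply/eqP; rewrite -subr_eq0 H.
    apply/seteqP; split => f /= H; first by rewrite H.
    exact/rowP.
  have := past_preimage M' tT (mG measurableT A mA); rewrite setTI.
  move=> /filtration_ae_eq; apply => //.
    rewrite -[X in measurable X]setTI.
    have := measurableT_comp (mbeta t tT) (@joint_path_measurable R p d T M').
    by apply.
  by apply: filterS (same_law_ae hlaw mE betaG) => w /= BG; rewrite /B' /= BG.
have mK : measurable (K : set (borel_rV R d)).
  by apply: measurable_closed_rV; exact: solvency_closed hK.
(* [B] follows [beta] almost surely, [B'] by definition, hence the different strength of the two
   equalities. *)
have functional t : 0 <= t <= T -> exists Psi : @path_space R p d T -> borel_rV R d,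
    [/\ measurable_fun setT Psi,
      {ae mm_prob M, forall w, Psi (joint_path w) = wealth x B t w} &
      forall w, Psi (joint_path w) = wealth x B' t w].
  move=> tT; have [Psi mPsi PsiE] := wealth_functional T_gt0 x hK mbeta tT.
  exists Psi; split => // [|w]; last by apply: PsiE => //; exact: sB'.2.
  by apply: filterS betaB => w; apply: PsiE; exact: sB.2.
exists B'.
  split => // t tT; have [Psi [mPsi PsiB PsiB']] := functional t tT.
  have mPsiK : measurable (Psi @^-1` K).
    by rewrite -[X in measurable X]setTI; apply: mPsi.
  have : {ae mm_prob M, forall w, (Psi @^-1` K) (joint_path w)}.
    by apply: filterS2 PsiB (BK t tT) => w /= ->.
  by move=> /(same_law_ae hlaw mPsiK); apply: filterS => w /=; rewrite PsiB'.
have TT : 0 <= T <= T by rewrite lexx ltW.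
have [Psi [mPsi PsiB PsiB']] := functional T TT.
(* Extending [U] by 0 off [K] turns the integral over [terminal_in] into one over the whole space of
   a function of the terminal wealth. *)
pose h : borel_rV R d -> \bar R := U \_ K.
have mh : measurable_fun setT h.
  by apply/(measurable_restrictT _ mK); exact: utility_borel hU.
have EU (N : market_model p d T) (C : R -> mm_space N -> 'rV[R]_d) :
    expected_utility K U x C = (\int[mm_prob N]_w h (wealth x C T w))%E.
  rewrite /expected_utility integral_mkcond; apply: eq_integral => w _.
  rewrite /h /patch; case: (boolP (wealth x C T w \in K)) => [/set_mem|/negP] wK.
    by rewrite mem_set.
  by rewrite memNset// => Kw; apply: wK; rewrite inE.
rewrite !EU; transitivity (\int[mm_prob M']_w h (Psi (joint_path w)))%E.
  by apply: eq_integral => w _; rewrite PsiB'.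
rewrite -(integral_same_law hlaw mh mPsi); apply: ae_eq_integral => //.
- apply: (measurableT_comp mh); apply: (measurableT_comp mPsi).
  exact: joint_path_measurable.
- by apply: (measurableT_comp mh); exact: (measurable_wealth T_gt0 x hK sB TT).
- by apply: filterS PsiB => w -> _.
Qed.

Lemma le_bellman (M M' : market_model p d T) : same_law M M' ->
  (bellman M K U x <= bellman M' K U x)%E.
Proof.
move=> hlaw; apply: ge_ereal_sup => _ [B aB <-].
have [B' aB' <-] := transfer_strategy hlaw aB.
by apply: ereal_sup_ubound; exists B'.
Qed.

End transfer.

Theorem theorem3p2 (R : realType) (p d : nat) (T : R)
  (p_gt0 : (0 < p)%N) (d_gt0 : (0 < d)%N) (T_gt0 : 0 < T)
  (K : set 'rV[R]_d) (U : 'rV[R]_d -> \bar R)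
  (hK : solvency_cone K) (hU : utility K U)
  (M M' : market_model p d T)
  (hM : expectations_defined M K U) (hM' : expectations_defined M' K U)
  (indepM : independent_increments (mm_prob M) T (mm_Y M))
  (indepM' : independent_increments (mm_prob M') T (mm_Y M'))
  (hlaw : same_law M M')
  (x : 'rV[R]_d) (hx : K x) :
  bellman M K U x = bellman M' K U x.
Proof.
(* The reverse inequality exchanges the models, so equality of laws is used in the other
   direction. *)
apply/eqP; rewrite eq_le !le_bellman// => A mA; exact/esym/hlaw.
Qed.
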